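(* Let $(G,\Gamma)$ be a Hecke pair and $X$ a set with a right $G$-action satisfying the $\Gamma$-intersection property. Then the map $\Phi:C_c(X/\Gamma)\times^{alg}_{\alpha}G/\Gamma\to C_c(X\times_{\Gamma}G/\Gamma)$ given by $$\Phi(f)(x,g):=\Delta(g)^{\frac12}f(g\Gamma)(x)$$ is a $*$-isomorphism. This map extends to a $*$-isomorphism between the reduced completions $\Phi:C_0(X/\Gamma)\times_{\alpha,r}G/\Gamma\to C^*_r(X\times_{\Gamma}G/\Gamma)$. Moreover, under the $*$-isomorphism $\Phi$, for each $x\in X$ the $*$-representation $\pi_x$ is just $(\widetilde{\varphi_x})_{\alpha}\times\rho$, i.e. $\pi_x\circ\Phi=(\widetilde{\varphi_x})_{\alpha}\times\rho$, where $\varphi_x$ is the $*$-representation of $C_0(X)$ given by evaluation at $x$, $\varphi_x(f)=f(x)$.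
   Context: **Hecke pairs.** $(G,\Gamma)$ is a Hecke pair if $\Gamma\subseteq G$ is a subgroup such that every double coset $\Gamma g\Gamma$ is a finite union of left (and of right) cosets. $\Gamma^g:=\Gamma\cap g\Gamma g^{-1}$, $L(g)=|\Gamma g\Gamma/\Gamma|$, $R(g)=|\Gamma\backslash\Gamma g\Gamma|$, $\Delta(g)=L(g)/R(g)$. The $G$-action on $X$ satisfies the $\Gamma$-intersection property if $x\Gamma\cap xg\Gamma g^{-1}=x\Gamma^g$ for all $x\in X$, $g\in G$. **The crossed product** (case of the trivial line bundle over the set $X$, viewed as a discrete groupoid consisting of units). Put $(\overline{\alpha}_gf)(x)=f(xg)$ for functions $f:X\to\mathbb{C}$. For a subgroup $H\subseteq G$, $C_c(X/H)$ is the algebra of finitely supported functions on $X/H$, viewed as $H$-invariant functions on $X$. $C_c(X/\Gamma)\times^{alg}_{\alpha}G/\Gamma$ is the $*$-algebra of finitely supported functions $f$ from $G/\Gamma$ to functions on $X$ with $f(g\Gamma)\in C_c(X/\Gamma^g)$ and $f(\gamma g\Gamma)=\overline{\alpha}_\gamma(f(g\Gamma))$ for $\gamma\in\Gamma$, with $(f_1*f_2)(g\Gamma)=\sum_{[h]\in G/\Gamma}f_1(h\Gamma)\,\overline{\alpha}_h(f_2(h^{-1}g\Gamma))$ and $f^*(g\Gamma)=\Delta(g^{-1})\,\overline{\overline{\alpha}_g(f(g^{-1}\Gamma))}$. **Reduced norm.** Let $\mathcal{C}$ be the set of finite intersections of conjugates of $\Gamma$, and $\mathcal{D}_r\subseteq\ell^\infty(X)$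 the $C^*$-algebra generated by all $C_c(X/H)$, $H\in\mathcal{C}$. For a nondegenerate $*$-representation $\pi$ of $\mathcal{D}_r$ on $\mathscr{H}$, $\pi_\alpha\times(1\otimes\rho)$ is the $*$-representation of $C_c(X/\Gamma)\times^{alg}_\alpha G/\Gamma$ on $\mathscr{H}\otimes\ell^2(G/\Gamma)$ given by $$[\pi_\alpha\times(1\otimes\rho)](f)(\xi\otimes\delta_{h\Gamma})=\sum_{[g]\in G/\Gamma}\Delta(g^{-1}h)^{1/2}\,\pi\big(\overline{\alpha}_g(f(g^{-1}h\Gamma))\big)\xi\otimes\delta_{g\Gamma}.$$ $C_0(X/\Gamma)\times_{\alpha,r}G/\Gamma$ is the completion in the norm $\|f\|_{r,r}=\sup_\pi\|[\pi_\alpha\times(1\otimes\rho)](f)\|$, the supremum being over all such $\pi$. $\widetilde{\varphi_x}$ is the extension of $\varphi_x$ to $M(C_0(X))=\ell^\infty(X)$ (evaluation at $x$), restricted to $\mathcal{D}_r$; since $\mathscr{H}=\mathbb{C}$, $(\widetilde{\varphi_x})_\alpha\times\rho$ acts on $\ell^2(G/\Gamma)$. **The Laca–Larsen–Neshveyev algebra** (adapted to right actions). $X\times_\Gamma G/\Gamma$ is the quotient of $X\times G$ by the right action of $\Gamma\times\Gamma$ given by $(x,g)(\gamma_1,\gamma_2)=(x\gamma_1,\gamma_1^{-1}g\gamma_2)$, a discrete space; $C_c(X\times_\Gamma G/\Gamma)$ is the space of finitely supported functions on it, viewed as $\Gamma\times\Gamma$-invariant functions on $X\times G$, with $(f_1*f_2)(x,g)=\sum_{[h]\in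 G/\Gamma}f_1(x,h)f_2(xh,h^{-1}g)$ and $f^*(x,g)=\overline{f(xg,g^{-1})}$. For $x\in X$, $\pi_x:C_c(X\times_\Gamma G/\Gamma)\to B(\ell^2(G/\Gamma))$ is $\pi_x(f)\delta_{h\Gamma}=\sum_{g\Gamma\in G/\Gamma}f(xg,g^{-1}h)\delta_{g\Gamma}$, and $C^*_r(X\times_\Gamma G/\Gamma)$ is the completion in the norm $\|f\|=\sup_{x\in X}\|\pi_x(f)\|$. *)

(* Defs.v *)
(* MathComp / MathComp-Analysis; the complex field is R[i] for R : realType. *)
From HB Require Import structures.
From mathcomp Require Import all_boot all_order all_algebra.
From mathcomp Require Import finmap sesquilinear complex.
From mathcomp Require Import all_classical all_reals all_analysis.
Import Order.TTheory GRing.Theory Num.Theory numFieldNormedType.Exports.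

Set Implicit Arguments.
Unset Strict Implicit.
Unset Printing Implicit Defensive.

Local Open Scope classical_set_scope.
Local Open Scope ring_scope.
Local Open Scope complex_scope.

Section HeckePairs.
Variables (G : groupType) (Gam : groupClosed G).

Definition lcoset (g : G) : set G := [set (g * k)%g | k in [set` Gam]].
Definition rcoset (g : G) : set G := [set (k * g)%g | k in [set` Gam]].
Definition dcoset (g : G) : set G :=
  [set (k * g * l)%g | k in [set` Gam] & l in [set` Gam]].

Definition lcosets_in (g : G) : set (set G) := [set lcoset h | h in dcoset g].
Definition rcosets_in (g : G) : set (set G) := [set rcoset h | h in dcoset g].

Definition Hecke_pair : Prop :=
  forall g, finite_set (lcosets_in g) /\ finite_set (rcosets_in g).

Definition Ldeg (g : G) : nat := #|` fset_set (lcosets_in g)|.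
Definition Rdeg (g : G) : nat := #|` fset_set (rcosets_in g)|.

Definition Delta (R : realType) (g : G) : R := (Ldeg g)%:R / (Rdeg g)%:R.

(* g Gamma g^-1, and Gamma^g *)
Definition conj_sub (g : G) : set G :=
  [set (g * k * g^-1)%g | k in [set` Gam]].
Definition conj_cap (g : G) : set G := [set` Gam] `&` conj_sub g.

(* The finite intersections of conjugates of Gamma.  The intersection of the
   empty family, G itself, is not one of them. *)
Definition inter_conj : set (set G) :=
  [set H | exists2 s : seq G, s != [::] & H = \bigcap_(g in [set` s]) conj_sub g].

(* G / Gamma, whose points are the left cosets themselves *)
Definition cosets := set_type (range lcoset).

Definition cls (g : G) : cosets := SigSub (mem_set (imageT lcoset g)).

(* A representative.  Every formula below that sums over [h] in G / Gamma, or
   that prescribes the value of a function at g Gamma, is evaluated at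
   representatives; the result does not depend on them, by the invariance of
   the functions involved. *)
Definition rep (q : cosets) : G := xget 1%g (val q).

End HeckePairs.

Record raction (X : Type) (G : groupType) := RAction {
  ract :> X -> G -> X;
  ract1 : forall x, ract x 1%g = x;
  ractM : forall x g h, ract x (g * h)%g = ract (ract x g) h }.

Section Actions.
Variables (R : realType) (G : groupType) (X : Type) (act : raction X G).

Definition orb (H : set G) (x : X) : set X := [set act x h | h in H].

Definition intersection_property (Gam : groupClosed G) : Prop :=
  forall x g,
    orb [set` Gam] x `&` orb (conj_sub Gam g) x = orb (conj_cap Gam g) x.

Definition alpha (g : G) (a : X -> R[i]) : X -> R[i] := fun x => a (act x g).

(* C_c(X/H), as H-invariant functions on X supported on finitely many
   H-orbits *)
Definition Cc (H : set G) : set (X -> R[i]) :=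
  [set a | (forall x h, H h -> a (act x h) = a x) /\
           finite_set [set orb H x | x in [set x | a x != 0]]].

End Actions.

(* A subset of a type with the operations of a complex *-algebra. *)
Record star_alg (C : Type) := StarAlg {
  sa_sort :> Type;
  sa_set : set sa_sort;
  sa_add : sa_sort -> sa_sort -> sa_sort;
  sa_scale : C -> sa_sort -> sa_sort;
  sa_mul : sa_sort -> sa_sort -> sa_sort;
  sa_star : sa_sort -> sa_sort }.

Arguments sa_set {C} s _.

Definition star_iso (C : Type) (A B : star_alg C) (phi : A -> B) : Prop :=
  [/\ set_bij (sa_set A) (sa_set B) phi,
      forall a b, sa_set A a -> sa_set A b ->
        phi (sa_add a b) = sa_add (phi a) (phi b),
      forall z a, sa_set A a -> phi (sa_scale z a) = sa_scale z (phi a),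
      forall a b, sa_set A a -> sa_set A b ->
        phi (sa_mul a b) = sa_mul (phi a) (phi b) &
      forall a, sa_set A a -> phi (sa_star a) = sa_star (phi a)].

(* The completion of A for a (semi)norm N: classes of Cauchy sequences modulo
   null sequences, with the operations induced by the termwise ones. *)
Section Completion.
Variables (R : realType) (A : star_alg R[i]) (N : A -> \bar R).

Let dist (a b : A) : \bar R := N (sa_add a (sa_scale (-1) b)).

Definition cauchy_in (u : nat -> A) : Prop :=
  (forall n, sa_set A (u n)) /\
  (forall e : R, 0 < e ->
     exists M, forall m n, (M <= m)%N -> (M <= n)%N -> (dist (u m) (u n) < e%:E)%E).

Definition coterminal (u v : nat -> A) : Prop :=
  dist (u n) (v n) @[n --> \oo] --> 0%E.

Definition seq_class (u : nat -> A) : set (nat -> A) :=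
  [set v | cauchy_in v /\ coterminal u v].

Definition completion_set : set (set (nat -> A)) :=
  [set seq_class u | u in cauchy_in].

Definition lift1 (f : A -> A) (P : set (nat -> A)) : set (nat -> A) :=
  \bigcup_(u in P) seq_class (f \o u).
Definition lift2 (f : A -> A -> A) (P Q : set (nat -> A)) : set (nat -> A) :=
  [set w | exists u v, [/\ P u, Q v & seq_class (fun n => f (u n) (v n)) w]].

Definition completion : star_alg R[i] :=
  @StarAlg R[i] (set (nat -> A)) completion_set
    (lift2 (@sa_add _ A)) (fun z => lift1 (sa_scale z))
    (lift2 (@sa_mul _ A)) (lift1 (@sa_star _ A)).

Definition to_completion (a : A) : completion := seq_class (fun=> a).

(* the common limit of N along the sequences in the class *)
Definition completion_norm (P : completion) : \bar R :=
  xget 0%E [set l | forall u, P u -> N (u n) @[n --> \oo] --> l].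

End Completion.

Section Operators.
Variables (R : realType) (I : choiceType).

(* l^2(I; V), the Hilbert space V (x) l^2(I): the elementary tensor
   xi (x) delta_i is the family with xi at i and 0 elsewhere. *)
Definition l2norm (V : normedZmodType R[i]) (v : I -> V) : \bar R :=
  ((\esum_(i in [set: I]) (complex.Re `|v i| ^+ 2)%:E) `^ 2^-1)%E.

Definition l2 (V : normedZmodType R[i]) : set (I -> V) :=
  [set v | (l2norm v < +oo)%E].

(* +oo if T is unbounded or does not preserve l^2 *)
Definition opnorm (V : normedZmodType R[i]) (T : (I -> V) -> (I -> V)) :
    \bar R :=
  ereal_sup [set l2norm (T v) | v in [set v : I -> V | (l2norm v <= 1)%E]].

(* T is the value, at the point P of the completion of A, of the continuous
   extension of a representation rho of A on l^2(I). *)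
Definition extension_value (A : star_alg R[i]) (V : normedZmodType R[i])
    (rho : A -> (I -> V) -> (I -> V)) (P : set (nat -> A))
    (T : (I -> V) -> (I -> V)) : Prop :=
  forall u, P u ->
    opnorm (fun v i => rho (u n) v i - T v i) @[n --> \oo] --> 0%E.

End Operators.

Arguments l2 {R I} V.

Record hilbert (R : realType) := Hilbert {
  hilbert_sort :> completeNormedModType R[i];
  hdot : {dot hilbert_sort for (@Num.conj R[i])};
  hdotE : forall xi : hilbert_sort, `|xi| ^+ 2 = hdot xi xi }.

Section BoundedFunctions.
Variables (R : realType) (X : Type).

Definition linfty : set (X -> R[i]) :=
  [set a | exists M : R, forall x, `|a x| <= M%:C].

(* norm-closed *-subalgebras of l^infty(X) *)
Definition Cstar_subalgebra (D : set (X -> R[i])) : Prop :=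
  [/\ D `<=` linfty /\ D (fun=> 0),
      forall a b, D a -> D b -> D (fun x => a x + b x),
      forall (z : R[i]) a, D a -> D (fun x => z * a x),
      (forall a b, D a -> D b -> D (fun x => a x * b x)) /\
      (forall a, D a -> D (fun x => (a x)^*)%R) &
      forall a, (forall e : R, 0 < e ->
                   exists2 b, D b & forall x, `|a x - b x| <= e%:C) -> D a].

(* pi is only meaningful on D. *)
Definition star_rep (D : set (X -> R[i])) (H : hilbert R)
    (pi : (X -> R[i]) -> H -> H) : Prop :=
  [/\ forall a, D a -> linear (pi a) /\
        exists M : R, forall xi, `|pi a xi| <= M%:C * `|xi|,
      forall a b xi, D a -> D b -> pi (fun x => a x + b x) xi = pi a xi + pi b xi,
      forall (z : R[i]) a xi, D a -> pi (fun x => z * a x) xi = z *: pi a xi,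
      forall a b xi, D a -> D b -> pi (fun x => a x * b x) xi = pi a (pi b xi) &
      forall a xi eta, D a ->
        hdot H (pi a xi) eta = hdot H xi (pi (fun x => (a x)^*)%R eta)].

Definition nondegenerate_rep (D : set (X -> R[i])) (H : hilbert R)
    (pi : (X -> R[i]) -> H -> H) : Prop :=
  star_rep D pi /\
  closure [set zeta : H | exists n (a : 'I_n -> X -> R[i]) (xi : 'I_n -> H),
             (forall i, D (a i)) /\ zeta = \sum_(i < n) pi (a i) (xi i)] = setT.

(* evaluation at x, as a representation on the one-dimensional space C *)
Definition ev (x : X) (a : X -> R[i]) (z : R[i]) : R[i] := a x * z.

End BoundedFunctions.

Section CrossedProduct.
Variables (R : realType) (G : groupType) (Gam : groupClosed G).
Variables (X : Type) (act : raction X G).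

Local Notation Delta := (Delta Gam R).
Local Notation cls := (cls Gam).
Local Notation cosets := (cosets Gam).
Local Notation alpha := (alpha (R := R) act).

Definition cp_set : set (cosets -> X -> R[i]) :=
  [set f | [/\ finite_set [set q | f q <> (fun=> 0)],
               forall g, Cc act (conj_cap Gam g) (f (cls g)) &
               forall k g, k \in Gam -> f (cls (k * g)%g) = alpha k (f (cls g))]].

Definition cp_mul (f1 f2 : cosets -> X -> R[i]) : cosets -> X -> R[i] :=
  fun q x => \sum_(p \in [set: cosets])
    f1 p x * alpha (rep p) (f2 (cls ((rep p)^-1 * rep q)%g)) x.

Definition cp_star (f : cosets -> X -> R[i]) : cosets -> X -> R[i] :=
  fun q x => (Delta ((rep q)^-1)%g)%:C *
    ((alpha (rep q) (f (cls ((rep q)^-1)%g)) x)^*)%R.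

(* C_c(X / Gamma) x^alg_alpha G / Gamma *)
Definition crossed_product : star_alg R[i] :=
  @StarAlg R[i] (cosets -> X -> R[i]) cp_set
    (fun f1 f2 q x => f1 q x + f2 q x) (fun z f q x => z * f q x) cp_mul cp_star.

Definition D_r : set (X -> R[i]) :=
  smallest (@Cstar_subalgebra R X)
    (\bigcup_(H in inter_conj Gam) Cc (R := R) act H).

(* pi_alpha x (1 (x) rho), written through its matrix coefficients: the sum
   over p is finite for f in the crossed product, and cp_rep_tensor below is
   the defining formula on the elementary tensors. *)
Definition cp_rep (V : lmodType R[i]) (pi : (X -> R[i]) -> V -> V)
    (f : cosets -> X -> R[i]) (v : cosets -> V) : cosets -> V :=
  fun q => \sum_(p \in [set: cosets])
    (Num.sqrt (Delta ((rep q)^-1 * rep p)%g))%:C *: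
      pi (alpha (rep q) (f (cls ((rep q)^-1 * rep p)%g))) (v p).

Lemma cp_rep_tensor (V : lmodType R[i]) (pi : (X -> R[i]) -> V -> V)
    (f : cosets -> X -> R[i]) (xi : V) (p : cosets) :
  (forall a, pi a 0 = 0) ->
  cp_rep pi f (fun p' => if p' == p then xi else 0) =
  fun q => (Num.sqrt (Delta ((rep q)^-1 * rep p)%g))%:C *:
             pi (alpha (rep q) (f (cls ((rep q)^-1 * rep p)%g))) xi.
Proof.
move=> pi0; apply/funext => q; rewrite /cp_rep -(fsbig_widen [set p] setT)//; last first.
  by move=> p' [_ /eqP /negbTE /= ->]; rewrite pi0 scaler0.
by rewrite fsbig_set1 eqxx.
Qed.

(* Here and in lln_norm the supremum is taken in [0, +oo], so that it is 0
   over the empty family. *)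
Definition cp_norm (f : crossed_product) : \bar R :=
  ereal_sup (0%E |`
    [set r | exists (H : hilbert R) (pi : (X -> R[i]) -> H -> H),
       nondegenerate_rep D_r pi /\ r = opnorm (cp_rep pi f)]).

(* The orbit of (x, g) under Gamma x Gamma, a point of X x_Gamma G / Gamma *)
Definition dorb (p : X * G) : set (X * G) :=
  [set (act p.1 k, (k^-1 * p.2 * l)%g) | k in [set` Gam] & l in [set` Gam]].

Definition lln_set : set (X * G -> R[i]) :=
  [set f | (forall p p', dorb p p' -> f p' = f p) /\
           finite_set [set dorb p | p in [set p | f p != 0]]].

Definition lln_mul (f1 f2 : X * G -> R[i]) : X * G -> R[i] :=
  fun '(x, g) => \sum_(p \in [set: cosets])
    f1 (x, rep p) * f2 (act x (rep p), ((rep p)^-1 * g)%g).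

Definition lln_star (f : X * G -> R[i]) : X * G -> R[i] :=
  fun '(x, g) => ((f (act x g, g^-1%g))^*)%R.

(* C_c(X x_Gamma G / Gamma) *)
Definition lln_algebra : star_alg R[i] :=
  @StarAlg R[i] (X * G -> R[i]) lln_set
    (fun f1 f2 p => f1 p + f2 p) (fun z f p => z * f p) lln_mul lln_star.

(* pi_x, written through its matrix coefficients like cp_rep *)
Definition lln_rep (x : X) (f : X * G -> R[i]) (v : cosets -> R[i]) :
    cosets -> R[i] :=
  fun q => \sum_(p \in [set: cosets])
    f (act x (rep q), ((rep q)^-1 * rep p)%g) * v p.

Lemma lln_rep_delta (x : X) (f : X * G -> R[i]) (p : cosets) :
  lln_rep x f (fun p' => if p' == p then 1 else 0) =
  fun q => f (act x (rep q), ((rep q)^-1 * rep p)%g).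
Proof.
apply/funext => q; rewrite /lln_rep -(fsbig_widen [set p] setT)//; last first.
  by move=> p' [_ /eqP /negbTE /= ->]; rewrite mulr0.
by rewrite fsbig_set1 eqxx mulr1.
Qed.

Definition lln_norm (f : lln_algebra) : \bar R :=
  ereal_sup (0%E |` [set opnorm (lln_rep x f) | x in [set: X]]).

Definition Phi (f : crossed_product) : lln_algebra :=
  fun '(x, g) => (Num.sqrt (Delta g))%:C * f (cls g) x.

(* C_0(X / Gamma) x_{alpha,r} G / Gamma and C*_r(X x_Gamma G / Gamma) *)
Definition cp_reduced : star_alg R[i] := completion cp_norm.
Definition lln_reduced : star_alg R[i] := completion lln_norm.

End CrossedProduct.

(* Main.v *)
Require Import Defs.
From HB Require Import structures.
From mathcomp Require Import all_boot all_order all_algebra.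
From mathcomp Require Import finmap sesquilinear complex.
From mathcomp Require Import ring.
From mathcomp Require Import all_classical all_reals all_analysis.
Import Order.TTheory GRing.Theory Num.Theory numFieldNormedType.Exports.

(** Why the theorem is true.

    Algebra.  The twist [f |-> Delta^(1/2) f] is multiplicative because [Delta]
    is a homomorphism ([DeltaM]).  For this, [Delta (g^-1 h)] is written as the
    ratio of the indices of [gKg^-1 ∩ hKh^-1] in [gKg^-1] and in [hKh^-1], with
    [K] standing for Gamma; such ratios form a cocycle on commensurable
    subgroups, as the index in a triple intersection can be computed along two
    towers ([coset_index_exchange], [coset_index_cocycle]).  The support
    conditions correspond because a point [(x, g)] modulo [Gamma x Gamma] amounts
    to a coset [g Gamma] and a [Gamma^g]-orbit of [x], up to the left action of
    [Gamma], whose orbits on [G / Gamma] are finite ([lln_set_Phi],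
    [cp_set_Phi_inv]).

    Norms.  The operators [pi_x (Phi f)] and [((ev x)_alpha x rho) f] have the same
    matrix coefficients ([lln_rep_Phi]).  Since [ev x] is a nondegenerate
    representation of [D_r] on the Hilbert space of complex numbers, the norm of
    [Phi f] is at most that of [f] ([lln_norm_le_cp_norm]).  Conversely let [pi] be
    any representation of [D_r].  A finite block of the operator attached to [f]
    is a matrix [pi (a q p)] whose entries [a q p] are functions taking finitely
    many values; the indicators of the joint level sets of the entries, apart from
    the level set of the zero matrix, are in [D_r] ([level_decomposition]), so
    [pi] sends them to mutually orthogonal projections.  On the range of one of
    them the block is a scalar matrix, namely the value [a q p x] at some point
    [x], tensored with an identity, and it is bounded by the norm of
    [pi_x (Phi f)] ([amplification], [rep_matrix_contraction]).  Hence both norms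
    coincide on the crossed product ([cp_norm_Phi]).

    Completions.  A norm preserving [*]-isomorphism acts on classes of Cauchy
    sequences, and every assertion about the completions is transported termwise
    along it ([completion_map_iso]). *)

Set Implicit Arguments.
Unset Strict Implicit.
Unset Printing Implicit Defensive.

Local Open Scope classical_set_scope.
Local Open Scope complex_scope.
Local Open Scope ring_scope.

(** * Indices of subgroups and the modular function *)

Section Counting.

Lemma card_fset_setX (T U : choiceType) (A : set T) (B : set U) :
  finite_set A -> finite_set B ->
  #|` fset_set (A `*` B)| = (#|` fset_set A| * #|` fset_set B|)%N.
Proof.
move=> fA fB; rewrite fset_setX// !cardfE -!cardfE.
rewrite -(size_allpairs pair (fset_set A) (fset_set B)).
apply/perm_size/uniq_perm; first exact: fset_uniq.
  by rewrite allpairs_uniq ?fset_uniq// => -[? ?] [? ?].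
move=> [x y]; rewrite in_fsetM/=; apply/andP/allpairsP => /=.
  by move=> [xA yB]; exists (x, y).
by move=> [[x' y'] /= [? ? [-> ->]]].
Qed.

(** Two maps on [A] with the same fibres have images of the same size; this is
    how all the coset spaces below are compared. *)
Lemma card_same_fibres (T U V : choiceType) (A : set T)
    (f : T -> U) (g : T -> V) :
  (forall x y, A x -> A y -> f x = f y <-> g x = g y) ->
  finite_set (f @` A) ->
  finite_set (g @` A) /\ #|` fset_set (f @` A)| = #|` fset_set (g @` A)|.
Proof.
move=> fg finA.
have [->|/set0P[a0 Aa0]] := eqVneq A set0.
  by rewrite !image_set0 !fset_set0; split=> //; rewrite !cardfs0.
pose phi u := g (xget a0 [set a | A a /\ f a = u]).
have phif a : A a -> phi (f a) = g a.
  move=> Aa; rewrite /phi; case: xgetP => [b _ [Ab fb]|/(_ a)[]//].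
  by apply/fg.
have gE : g @` A = phi @` (f @` A).
  rewrite image_comp; apply: eq_imagel => a Aa /=; exact/esym/phif.
split; first by rewrite gE; exact: finite_image.
rewrite gE (fset_set_image phi)//; apply/esym/eqP/card_in_imfsetP => u v.
rewrite !in_fset_set// !inE => -[a Aa <-] [b Ab <-].
by rewrite !phif// => /fg; apply.
Qed.

End Counting.

Section SubgroupIndex.
Variable G : groupType.
Implicit Types (A B C : set G) (g h : G).

Definition subgroup_set A : Prop :=
  A 1%g /\ forall a b, A a -> A b -> A (a^-1 * b)%g.

Definition left_coset A g : set G := [set (g * k)%g | k in A].

Definition coset_index A B : nat := #|` fset_set (left_coset B @` A)|.

Definition finite_coset_index A B : Prop := finite_set (left_coset B @` A).

Lemma subgroup_setV A a : subgroup_set A -> A a -> A a^-1%g.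
Proof. by move=> [A1 AF] Aa; rewrite -[a^-1%g]mulg1; apply: AF. Qed.

Lemma subgroup_setM A a b : subgroup_set A -> A a -> A b -> A (a * b)%g.
Proof.
by move=> sA Aa Ab; rewrite -[a]invgK; apply: sA.2 => //; exact: subgroup_setV.
Qed.

Lemma subgroup_setI A B :
  subgroup_set A -> subgroup_set B -> subgroup_set (A `&` B).
Proof.
move=> [A1 AF] [B1 BF]; split=> // a b [Aa Ba] [Ab Bb].
by split; [exact: AF|exact: BF].
Qed.

Lemma left_coset_eqP A g h :
  subgroup_set A -> left_coset A g = left_coset A h <-> A (g^-1 * h)%g.
Proof.
move=> sA; split=> [gh|Agh].
  have : left_coset A g h by rewrite gh; exists 1%g; rewrite ?mulg1//; exact: sA.1.
  by move=> [k Ak <-]; rewrite mulKg.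
rewrite eqEsubset; split=> _ [k Ak <-].
  exists ((g^-1 * h)^-1 * k)%g; first exact: sA.2.
  by rewrite invgM invgK -mulgA mulVKg.
by exists (g^-1 * h * k)%g; [exact: subgroup_setM|rewrite mulgA mulVKg].
Qed.

Lemma coset_index_gt0 A B :
  subgroup_set A -> finite_coset_index A B -> (0 < coset_index A B)%N.
Proof.
move=> sA fAB; rewrite cardfs_gt0; apply/fset0Pn.
exists (left_coset B 1%g); rewrite in_fset_set// inE.
by exists 1%g => //; exact: sA.1.
Qed.

(** With [r a] a representative in [A] of [a B], the coset [a (B ∩ C)] is
    determined by the pair of [a B] and [r(a)^-1 a C], and every pair of
    [A / A ∩ B] and [A ∩ B / A ∩ B ∩ C] occurs. *)
Lemma coset_index_tower A B C :
  subgroup_set A -> subgroup_set B -> subgroup_set C ->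
  finite_coset_index A B -> finite_coset_index (A `&` B) C ->
  coset_index A (B `&` C) = (coset_index A B * coset_index (A `&` B) C)%N.
Proof.
move=> sA sB sC fAB fABC.
pose r a := xget 1%g [set b | A b /\ left_coset B b = left_coset B a].
have rP a : A a -> A (r a) /\ left_coset B (r a) = left_coset B a.
  by move=> Aa; rewrite /r; case: xgetP => [b _ //|/(_ a)[]].
have rE a b : left_coset B a = left_coset B b -> r a = r b by rewrite /r => ->.
have rB a : A a -> B ((r a)^-1 * a)%g.
  by move=> /rP[_ /left_coset_eqP]; exact.
pose split_coset a := (left_coset B a, left_coset C ((r a)^-1 * a)%g).
have imE : split_coset @` A =
    (left_coset B @` A) `*` (left_coset C @` (A `&` B)).
  rewrite eqEsubset; split=> [_ [a Aa <-]|[_ _] [/= [a Aa <-] [d [Ad Bd] <-]]].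
    split; first by exists a.
    exists ((r a)^-1 * a)%g => //; split; last exact: rB.
    by apply: sA.2 => //; case: (rP a Aa).
  have [Ara Bra] := rP a Aa.
  have rd : left_coset B (r a * d)%g = left_coset B a.
    by rewrite -Bra; apply/esym/left_coset_eqP => //; rewrite mulKg.
  exists (r a * d)%g; first exact: subgroup_setM.
  by rewrite /split_coset rd (rE _ _ rd) mulKg.
rewrite /coset_index -card_fset_setX// -imE.
have fim : finite_set (split_coset @` A) by rewrite imE; exact: finite_setX.
suff fib a b : A a -> A b -> split_coset a = split_coset b <->
    left_coset (B `&` C) a = left_coset (B `&` C) b.
  by have [_ ->] := card_same_fibres fib fim.
move=> Aa Ab; rewrite (left_coset_eqP _ _ (subgroup_setI sB sC)).
split=> [[/= Bab]|[Bab Cab]].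
  move/(left_coset_eqP _ _ sC); rewrite (rE _ _ Bab).
  rewrite invgM invgK -mulgA mulVKg => ?; split=> //.
  exact/left_coset_eqP.
have /left_coset_eqP-/(_ sB) aB := Bab.
congr (_, _) => //; apply/left_coset_eqP => //.
by rewrite (rE _ _ aB) invgM invgK -mulgA mulVKg.
Qed.

Lemma finite_coset_indexS A B C :
  A `<=` B -> finite_coset_index B C -> finite_coset_index A C.
Proof. by move=> AB; apply: sub_finite_set; exact: image_subset. Qed.

(** Both sides count the cosets of [A ∩ B ∩ C] in [A]. *)
Lemma coset_index_exchange A B C :
  subgroup_set A -> subgroup_set B -> subgroup_set C ->
  finite_coset_index A B -> finite_coset_index A C ->
  (coset_index A B * coset_index (A `&` B) C =
   coset_index A C * coset_index (A `&` C) B)%N.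
Proof.
move=> sA sB sC fAB fAC; rewrite -!coset_index_tower// 1?setIC//.
- by apply: finite_coset_indexS fAB => x [].
- by apply: finite_coset_indexS fAC => x [].
Qed.

(** The ratio [[A : A ∩ B] / [B : A ∩ B]] is a cocycle on pairwise
    commensurable subgroups: the three triple indices cancel. *)
Lemma coset_index_cocycle (F : numFieldType) A B C :
  subgroup_set A -> subgroup_set B -> subgroup_set C ->
  finite_coset_index A B -> finite_coset_index B A ->
  finite_coset_index A C -> finite_coset_index C A ->
  finite_coset_index B C -> finite_coset_index C B ->
  (coset_index A B)%:R / (coset_index B A)%:R =
  (coset_index A C)%:R / (coset_index C A)%:R *
  ((coset_index C B)%:R / (coset_index B C)%:R) :> F.
Proof.
move=> sA sB sC fAB fBA fAC fCA fBC fCB.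
have nz A' B' : subgroup_set A' -> finite_coset_index A' B' ->
    (coset_index A' B')%:R != 0 :> F.
  by move=> sA' fAB'; rewrite pnatr_eq0 -lt0n coset_index_gt0.
have nz3 A' B' C' : subgroup_set A' -> subgroup_set B' ->
    finite_coset_index A' C' -> (coset_index (A' `&` B') C')%:R != 0 :> F.
  move=> sA' sB' fAC'; apply: nz; first exact: subgroup_setI.
  by apply: finite_coset_indexS fAC' => x [].
have /(congr1 (fun n => n%:R : F)) := coset_index_exchange sA sB sC fAB fAC.
have /(congr1 (fun n => n%:R : F)) := coset_index_exchange sB sA sC fBA fBC.
have /(congr1 (fun n => n%:R : F)) := coset_index_exchange sC sA sB fCA fCB.
rewrite !natrM (setIC B A) (setIC C A) (setIC C B).
have := nz3 _ _ _ sA sB fAC; have := nz3 _ _ _ sA sC fAB.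
have := nz3 _ _ _ sB sC fBA.
have := nz _ _ sA fAB; have := nz _ _ sB fBA; have := nz _ _ sA fAC.
have := nz _ _ sC fCA; have := nz _ _ sB fBC; have := nz _ _ sC fCB.
move: (coset_index A B)%:R (coset_index B A)%:R (coset_index A C)%:R
  (coset_index C A)%:R (coset_index C B)%:R (coset_index B C)%:R
  (coset_index (A `&` B) C)%:R (coset_index (A `&` C) B)%:R
  (coset_index (B `&` C) A)%:R => ab ba ac ca cb bc c b a.
move=> cb0 bc0 ca0 ac0 ba0 ab0 a0 b0 c0 e1 e2 e3.
have -> : ab = ac * b / c by rewrite -e3 mulfK.
have -> : ba = bc * a / c by rewrite -e2 mulfK.
have -> : ca = cb * a / b by rewrite -e1 mulfK.
rewrite !invfM !invrK; field.
by rewrite ?(cb0, bc0, ca0, ac0, ba0, ab0, a0, b0, c0).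
Qed.

End SubgroupIndex.

(* normal form of a word: inverses pushed in, left-associated, cancelled *)
Ltac group_nf := rewrite ?(invgM, invgK, invg1, mulgA, mulgK, mulgVK, mulVg,
  mulgV, mul1g, mulg1).

Section Modular.
Variables (G : groupType) (Gam : groupClosed G).
Implicit Types (g h k l : G) (p q : cosets Gam).

Local Notation lcoset := (lcoset Gam).
Local Notation rcoset := (rcoset Gam).
Local Notation Gconj := (conj_sub Gam).
Local Notation cls := (cls Gam).

Lemma subgroup_set_group : subgroup_set [set` Gam].
Proof.
split=> [|a b /= aG bG]; first exact: gpred1.
by apply: gpredM => //; rewrite gpredV.
Qed.

Lemma conj_subP g h : Gconj g h <-> (g^-1 * h * g)%g \in Gam.
Proof.
split=> [[k kG <-]|ghG]; first by rewrite !mulgA mulVg mul1g mulgVK.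
by exists (g^-1 * h * g)%g => //; rewrite !mulgA mulgV mul1g mulgK.
Qed.

Lemma subgroup_set_conj g : subgroup_set (Gconj g).
Proof.
split=> [|a b]; rewrite !conj_subP ?mulg1 ?mulVg ?gpred1// => aG bG.
have -> : (g^-1 * (a^-1 * b) * g = (g^-1 * a * g)^-1 * (g^-1 * b * g))%g.
  by rewrite !invgM invgK !mulgA mulgK.
by apply: gpredM => //; rewrite gpredV.
Qed.

Lemma lcoset_eqP g h : lcoset g = lcoset h <-> (g^-1 * h)%g \in Gam.
Proof. exact: (left_coset_eqP _ _ subgroup_set_group). Qed.

Lemma rcoset_eqP g h : rcoset g = rcoset h <-> (g * h^-1)%g \in Gam.
Proof.
split=> [gh|ghG].
  have : rcoset h g by rewrite -gh; exists 1%g; rewrite ?mul1g//; exact: gpred1.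
  by move=> [k kG <-]; rewrite mulgK.
rewrite eqEsubset; split=> _ [k kG <-].
  exists (k * (g * h^-1))%g; last by rewrite !mulgA mulgVK.
  exact: gpredM.
exists (k * (g * h^-1)^-1)%g; last by rewrite invgM invgK !mulgA mulgVK.
by rewrite /= gpredM// gpredV.
Qed.

Lemma lcosets_inE g :
  lcosets_in Gam g = (fun k => lcoset (k * g)%g) @` [set` Gam].
Proof.
rewrite eqEsubset; split=> [_ [_ [k kG [l lG <-]] <-]|_ [k kG <-]].
  by exists k => //; apply/lcoset_eqP; group_nf.
exists (k * g * 1)%g; last by rewrite mulg1.
by exists k => //; exists 1%g => //; exact: gpred1.
Qed.

Lemma rcosets_inE g :
  rcosets_in Gam g = (fun k => rcoset (g * k)%g) @` [set` Gam].
Proof.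
rewrite eqEsubset; split=> [_ [_ [k kG [l lG <-]] <-]|_ [k kG <-]].
  by exists l => //; apply/rcoset_eqP; group_nf; rewrite gpredV.
exists (1 * g * k)%g; last by rewrite mul1g.
by exists 1%g; [exact: gpred1|exists k].
Qed.

Hypothesis hecke : Hecke_pair Gam.

(** The cosets [a hKh^-1] with [a] in [gKg^-1] are, up to a right translation
    by [h^-1] and a left one by [g], the left cosets in [K g^-1 h K], where [K]
    stands for [Gamma]. *)
Lemma index_conjE g h :
  finite_coset_index (Gconj g) (Gconj h) /\
  coset_index (Gconj g) (Gconj h) = Ldeg Gam (g^-1 * h)%g.
Proof.
have finL : finite_set (lcosets_in Gam (g^-1 * h)%g) by case: (hecke (g^-1 * h)%g).
rewrite /finite_coset_index /coset_index /Ldeg.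
rewrite {2}/conj_sub image_comp; move: finL; rewrite lcosets_inE => finL.
have fib k l : k \in Gam -> l \in Gam ->
    lcoset (k * (g^-1 * h))%g = lcoset (l * (g^-1 * h))%g <->
    left_coset (Gconj h) (g * k * g^-1)%g = left_coset (Gconj h) (g * l * g^-1)%g.
  move=> kG lG; rewrite lcoset_eqP (left_coset_eqP _ _ (subgroup_set_conj h)).
  by rewrite conj_subP; group_nf.
have [fin ->] := card_same_fibres fib finL; split=> //.
Qed.

(** Inversion exchanges left and right cosets. *)
Lemma RdegE g : Rdeg Gam g = Ldeg Gam g^-1%g.
Proof.
have [_] := hecke g; rewrite /Rdeg /Ldeg rcosets_inE lcosets_inE => finR.
have fib k l : k \in Gam -> l \in Gam ->
    rcoset (g * k)%g = rcoset (g * l)%g <->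
    lcoset (k^-1 * g^-1)%g = lcoset (l^-1 * g^-1)%g.
  by move=> kG lG; rewrite rcoset_eqP lcoset_eqP; group_nf.
have [_ ->] := card_same_fibres fib finR.
congr #|` fset_set _|; rewrite eqEsubset; split=> _ [k /= kG <-].
  by exists k^-1%g; rewrite //= gpredV.
by exists k^-1%g; rewrite /= ?gpredV// invgK.
Qed.

Variable R : realType.
Local Notation Delta := (Delta Gam R).

Lemma Delta_conjE g h : Delta (g^-1 * h)%g =
  (coset_index (Gconj g) (Gconj h))%:R / (coset_index (Gconj h) (Gconj g))%:R.
Proof.
by rewrite (index_conjE g h).2 (index_conjE h g).2 /Delta RdegE invgM invgK.
Qed.

(** The cocycle identity for [Gamma] and its conjugates by [g] and [g h]. *)
Lemma DeltaM g h : Delta (g * h)%g = Delta g * Delta h.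
Proof.
have -> : (g * h = 1^-1 * (g * h))%g by group_nf.
rewrite Delta_conjE (@coset_index_cocycle _ R _ _ (Gconj g)); last 1 first.
all: try exact: subgroup_set_conj.
all: try exact: (index_conjE _ _).1.
by rewrite -!Delta_conjE; group_nf.
Qed.

Lemma Delta_gt0 g : 0 < Delta g.
Proof.
have -> : (g = 1^-1 * g)%g by group_nf.
by rewrite Delta_conjE divr_gt0// ltr0n coset_index_gt0//;
  do ?[exact: subgroup_set_conj|exact: (index_conjE _ _).1].
Qed.

Lemma Delta_group k : k \in Gam -> Delta k = 1.
Proof.
move=> kG; have -> : (k = 1^-1 * k)%g by group_nf.
suff : Gconj k = Gconj 1%g.
  by rewrite Delta_conjE => ->; rewrite divff// pnatr_eq0 -lt0n coset_index_gt0//;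
  do ?[exact: subgroup_set_conj|exact: (index_conjE _ _).1].
by apply/seteqP; split=> h; rewrite !conj_subP; group_nf;
  rewrite gpredMr// gpredMl// gpredV.
Qed.

Lemma DeltaV g : Delta g^-1%g = (Delta g)^-1.
Proof.
apply: (mulIf (lt0r_neq0 (Delta_gt0 g))).
by rewrite -DeltaM mulVg Delta_group ?gpred1// mulVf// lt0r_neq0// Delta_gt0.
Qed.

Lemma Delta_double k g l : k \in Gam -> l \in Gam -> Delta (k * g * l)%g = Delta g.
Proof. by move=> kG lG; rewrite !DeltaM (Delta_group kG) (Delta_group lG) mul1r mulr1. Qed.

End Modular.

(** * The algebraic isomorphism *)

Section FiniteImages.

Lemma finite_image_factor (T : Type) (U V : choiceType) (A : set T)
    (f : T -> U) (g : T -> V) :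
  (forall x y, A x -> A y -> f x = f y -> g x = g y) ->
  finite_set (f @` A) -> finite_set (g @` A).
Proof.
elim/Pchoice: T => T in A f g *.
move=> fg finA; have [->|/set0P[a0 Aa0]] := eqVneq A set0.
  by rewrite image_set0.
suff -> : g @` A = (fun u => g (xget a0 [set a | A a /\ f a = u])) @` (f @` A).
  exact: finite_image.
rewrite image_comp; apply: eq_imagel => a Aa /=; apply/esym.
by case: xgetP => [b _ [Ab fb]|/(_ a)[]//]; exact: fg Ab Aa fb.
Qed.

Lemma finite_image_section (T U : Type) (A : set T) (f : T -> U) :
  finite_set (f @` A) ->
  exists P : set T, finite_set P /\
    forall a, A a -> exists2 b, P b & f b = f a.
Proof.
elim/Pchoice: T => T in A f *; move=> finA.
have [->|/set0P[a0 Aa0]] := eqVneq A set0; first by exists set0.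
pose r u := xget a0 [set a | f a = u].
exists (r @` (f @` A)); split; first exact: finite_image.
move=> a Aa; exists (r (f a)); first by exists (f a) => //; exists a.
by rewrite /r; case: xgetP => [b _ //|/(_ a)/(_ erefl)].
Qed.

End FiniteImages.

Section Cosets.
Variables (G : groupType) (Gam : groupClosed G).
Implicit Types (g h k l : G) (p q : cosets Gam).

Local Notation cls := (cls Gam).

Lemma cls_eqP g h : cls g = cls h <-> (g^-1 * h)%g \in Gam.
Proof.
rewrite -lcoset_eqP; split=> [/(congr1 val)//|gh].
exact: val_inj.
Qed.

Lemma repK q : cls (rep q) = q.
Proof.
apply: val_inj; rewrite -[LHS]/(lcoset Gam (rep q)) /rep.
have /set_mem[g _ gq] := valP q; rewrite -gq.
case: xgetP => [h _ [k kG <-]|/(_ g)[]].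
  by apply/lcoset_eqP; group_nf; rewrite gpredV.
by exists 1%g; rewrite ?mulg1//; exact: gpred1.
Qed.

Lemma rep_cls g : exists2 k, k \in Gam & rep (cls g) = (g * k)%g.
Proof.
have /esym/cls_eqP gk := repK (cls g).
by exists (g^-1 * rep (cls g))%g => //; group_nf.
Qed.

Lemma cls_group g k : k \in Gam -> cls (g * k)%g = cls g.
Proof. by move=> kG; apply/cls_eqP; group_nf; rewrite gpredV. Qed.

(** [G] acts on [G / Gamma] by left translation; sums over the coset space are
    reindexed along it. *)
Definition ltrans g q : cosets Gam := cls (g * rep q)%g.

Lemma ltrans_cls g h : ltrans g (cls h) = cls (g * h)%g.
Proof.
by rewrite /ltrans; have [k kG ->] := rep_cls h; rewrite mulgA (cls_group _ kG).
Qed.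

Lemma ltransK g : cancel (ltrans g) (ltrans g^-1%g).
Proof. by move=> q; rewrite {2}/ltrans ltrans_cls mulKg repK. Qed.

Lemma ltrans_bij g : bijective (ltrans g).
Proof.
by exists (ltrans g^-1%g); [|rewrite -{2}[g]invgK]; exact: ltransK.
Qed.

Lemma finite_cls_double g : Hecke_pair Gam ->
  finite_set ((fun k => cls (k * g)%g) @` [set` Gam]).
Proof.
move=> /(_ g)[]; rewrite lcosets_inE => finL _; apply: finite_image_factor finL.
by move=> k l _ _ kl; apply: val_inj.
Qed.

End Cosets.

Section AlgebraicIsomorphism.
Variables (R : realType) (G : groupType) (Gam : groupClosed G).
Variables (X : Type) (act : raction X G).
Hypothesis hecke : Hecke_pair Gam.
Implicit Types (g h k l : G) (p q : cosets Gam) (x y : X).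

Local Notation Delta := (Delta Gam R).
Local Notation cls := (cls Gam).
Local Notation dorb := (dorb Gam act).
Local Notation cp := (crossed_product R Gam act).
Local Notation lln := (lln_algebra R Gam act).
Local Notation Phi := (@Phi R G Gam X act).
Local Notation lln_set := (@lln_set R G Gam X act).
Local Notation cp_set := (@cp_set R G Gam X act).
Local Notation sqrtDelta g := ((Num.sqrt (Delta g))%:C).

Lemma orb_act (H : set G) x h : subgroup_set H -> H h ->
  orb act H (act x h) = orb act H x.
Proof.
move=> sH Hh; apply/seteqP; split=> _ [k Hk <-].
  by exists (h * k)%g; [exact: subgroup_setM|rewrite ractM].
by exists (h^-1 * k)%g; [exact: sH.2|rewrite -ractM mulVKg].
Qed.

Lemma dorb_refl (z : X * G) : dorb z z.
Proof.
exists 1%g; first exact: gpred1.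
exists 1%g; first exact: gpred1.
by case: z => x g /=; rewrite ract1; group_nf.
Qed.

Lemma dorbP x g y h : dorb (x, g) (y, h) <->
  exists k l, [/\ k \in Gam, l \in Gam, y = act x k & h = (k^-1 * g * l)%g].
Proof.
split=> [[k kG [l lG [<- <-]]]|[k [l [kG lG -> ->]]]]; first by exists k, l.
by exists k => //; exists l.
Qed.

Lemma dorb_sub z w : dorb z w -> dorb w `<=` dorb z.
Proof.
case: z w => x g [y h] /dorbP[k [l [kG lG -> ->]]] [x' g'].
move=> /dorbP[k' [l' [kG' lG' -> ->]]]; apply/dorbP; exists (k * k')%g, (l * l')%g.
by split; [exact: gpredM|exact: gpredM|rewrite ractM|group_nf].
Qed.

Lemma dorb_sym z w : dorb z w -> dorb w z.
Proof.
case: z w => x g [y h] /dorbP[k [l [kG lG -> ->]]].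
apply/dorbP; exists k^-1%g, l^-1%g; split; rewrite ?gpredV//.
  by rewrite -ractM mulgV ract1.
by group_nf.
Qed.

Lemma dorb_eqP z w : dorb z = dorb w <-> dorb z w.
Proof.
split=> [->|zw]; first exact: dorb_refl.
by apply/seteqP; split; apply: dorb_sub => //; exact: dorb_sym.
Qed.

Lemma sqrtDelta_neq0 g : sqrtDelta g != 0.
Proof. by rewrite eq_complex /= eqxx andbT gt_eqF// sqrtr_gt0 Delta_gt0. Qed.

Lemma sqrtDeltaM g h : sqrtDelta (g * h)%g = sqrtDelta g * sqrtDelta h.
Proof. by rewrite DeltaM// sqrtrM ?rmorphM// ltW// Delta_gt0. Qed.

Lemma Delta_rep_cls g : Delta (rep (cls g)) = Delta g.
Proof.
have [k kG ->] := rep_cls Gam g.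
by rewrite -[(g * k)%g]mul1g mulgA Delta_double// gpred1.
Qed.

Definition Phi_inv (F : lln) : cp :=
  fun q x => (sqrtDelta (rep q))^-1 * F (x, rep q).

Lemma Phi_invK (f : cp) : Phi_inv (Phi f) = f.
Proof.
apply/funext => q; apply/funext => x.
by rewrite /Phi_inv /= repK mulKf// sqrtDelta_neq0.
Qed.

Lemma Phi_inv_cls (F : lln) g x : lln_set F ->
  Phi_inv F (cls g) x = (sqrtDelta g)^-1 * F (x, g).
Proof.
move=> [Finv _]; rewrite /Phi_inv Delta_rep_cls; congr (_ * _).
have [k kG ->] := rep_cls Gam g; apply: Finv; apply/dorbP.
by exists 1%g, k; rewrite gpred1 ract1 invg1 mul1g.
Qed.

Lemma PhiK (F : lln) : lln_set F -> Phi (Phi_inv F) = F.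
Proof.
move=> sF; apply/funext => -[x g] /=.
by rewrite Phi_inv_cls// mulVKf// sqrtDelta_neq0.
Qed.

(** Up to the scalar, [Phi f (x, g)] is [f (g Gamma) x]; a point of the support
    is determined modulo [Gamma x Gamma] by the coset [g Gamma] and the
    [Gamma^g]-orbit of [x]. *)
Lemma lln_set_Phi (f : cp) : cp_set f -> lln_set (Phi f).
Proof.
move=> [finf fCc finv]; split.
  move=> [x g] [_ _] /dorbP[k [l [kG lG -> ->]]] /=.
  rewrite Delta_double ?gpredV// cls_group// finv ?gpredV// /alpha.
  by rewrite -ractM mulgV ract1.
pose stab q := conj_cap Gam (rep q).
pose coord (z : X * G) := (cls z.2, orb act (stab (cls z.2)) z.1).
apply: (@finite_image_factor _ _ _ _ coord).
  move=> [x g] [y h] _ _ e; apply/dorb_eqP/dorbP.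
  have gh : cls g = cls h := congr1 fst e.
  have : orb act (stab (cls g)) x y.
    have -> : orb act (stab (cls g)) x = orb act (stab (cls h)) y := congr1 snd e.
    exists 1%g; last exact: ract1.
    by split; [exact: gpred1|apply/conj_subP; group_nf; exact: gpred1].
  move=> [t [tG /conj_subP]]; have [k kG ->] := rep_cls Gam g.
  move: gh => /cls_eqP gh; group_nf => tgG <-; exists t, (g^-1 * t * h)%g.
  split=> //; last by group_nf.
  have -> : (g^-1 * t * h = k * (k^-1 * g^-1 * t * g * k) * k^-1 * (g^-1 * h))%g.
    by group_nf.
  by rewrite gpredM// gpredM ?gpredV// gpredM.
pose Q := [set q | f q <> fun=> 0].
pose O q := [set orb act (stab q) x | x in [set x | f q x != 0]].
apply: (@sub_finite_set _ _ (Q `*`` O)).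
  move=> _ [[x g] /= + <-]; rewrite mulf_eq0 negb_or => /andP[_ fx].
  split=> /=; last by exists x.
  by move=> f0; move: fx; rewrite f0 eqxx.
apply: finite_setXR => // q _.
by case: (fCc (rep q)); rewrite repK.
Qed.

Lemma finite_dorbP (F : lln) :
  finite_set [set dorb z | z in [set z | F z != 0]] ->
  exists P : set (X * G), finite_set P /\
    forall z, F z != 0 -> exists2 w, P w & dorb w z.
Proof.
move=> /finite_image_section[P [finP PF]]; exists P; split=> // z /PF[w Pw].
by move=> /dorb_eqP wz; exists w.
Qed.

(** The support of [F] meets finitely many double cosets, each of which has
    finitely many left cosets because of the Hecke condition. *)
Lemma cp_set_Phi_inv (F : lln) : lln_set F -> cp_set (Phi_inv F).
Proof.
move=> sF; have [Finv finF] := sF; split.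
- have [P [finP PF]] := finite_dorbP finF.
  apply: (@sub_finite_set _ _
    (\bigcup_(z in P) (fun k => cls (k * z.2)%g) @` [set` Gam])).
    move=> q /= Fq; have [x Fx] : exists x, F (x, rep q) != 0.
      apply/not_existsP => F0; apply: Fq; apply/funext => x.
      by rewrite /Phi_inv; have /negP/negPn/eqP-> := F0 x; rewrite mulr0.
    have [[y h] Pz /dorbP[k [l [kG lG _ qE]]]] := PF _ Fx.
    exists (y, h) => //; exists k^-1%g; rewrite /= ?gpredV//.
    by rewrite -[RHS]repK qE (cls_group _ lG).
  by apply: bigcup_finite => // z _; exact: finite_cls_double.
- move=> g; split.
    move=> x h [hG /conj_subP gh]; rewrite !Phi_inv_cls//; congr (_ * _).
    apply: Finv; apply/dorbP; exists h, (g^-1 * h * g)%g; split=> //.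
    by group_nf.
  apply: (@finite_image_factor _ _ _ _ (fun x => dorb (x, g))); last first.
    apply: sub_finite_set finF => _ [x /= + <-].
    rewrite Phi_inv_cls// mulf_eq0 negb_or => /andP[_ Fx].
    by exists (x, g).
  move=> x y _ _ /dorb_eqP/dorbP[k [l [kG lG -> gE]]].
  apply/esym/orb_act; last split=> //.
    exact: subgroup_setI (subgroup_set_group Gam) (subgroup_set_conj Gam g).
  have kg : (k * g = g * l)%g by rewrite {1}gE; group_nf.
  by apply/conj_subP; rewrite -mulgA kg; group_nf.
- move=> k g kG; apply/funext => x; rewrite /alpha !Phi_inv_cls//.
  rewrite -[(k * g)%g]mulg1 Delta_double ?gpred1// mulg1; congr (_ * _).
  apply/esym/Finv/dorbP; exists k, 1%g; split=> //; first exact: gpred1.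
  by group_nf.
Qed.

Lemma cp_set_PhiE (f : cp) : cp_set f <-> lln_set (Phi f).
Proof.
split; first exact: lln_set_Phi.
by move=> /cp_set_Phi_inv; rewrite Phi_invK.
Qed.

Lemma Phi_bij : set_bij (sa_set cp) (sa_set lln) Phi.
Proof.
split; first exact: lln_set_Phi.
  by move=> f f' _ _ /(congr1 Phi_inv); rewrite !Phi_invK.
by move=> F sF; exists (Phi_inv F); [exact: cp_set_Phi_inv|exact: PhiK].
Qed.

Lemma Phi_add (f1 f2 : cp) : Phi (sa_add f1 f2) = sa_add (Phi f1) (Phi f2).
Proof. by apply/funext => -[x g] /=; rewrite mulrDr. Qed.

Lemma Phi_scale z (f : cp) : Phi (sa_scale z f) = sa_scale z (Phi f).
Proof. by apply/funext => -[x g] /=; rewrite mulrCA. Qed.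

(** The twist by [Delta ^ 1/2] is compatible with convolution because [Delta] is
    multiplicative. *)
Lemma Phi_mul (f1 f2 : cp) : Phi (sa_mul f1 f2) = sa_mul (Phi f1) (Phi f2).
Proof.
apply/funext => -[x g] /=; rewrite /cp_mul mulr_fsumr.
apply: eq_fsbigr => p _; rewrite /alpha.
have [k kG ->] := rep_cls Gam g; rewrite [(_ * (g * k))%g]mulgA (cls_group _ kG).
have -> : sqrtDelta g = sqrtDelta (rep p) * sqrtDelta ((rep p)^-1 * g)%g.
  by rewrite -sqrtDeltaM mulVKg.
by rewrite repK mulrACA.
Qed.

(** The factor [Delta (g^-1)] in the involution turns [Delta g ^ 1/2] into
    [Delta (g^-1) ^ 1/2]. *)
Lemma Phi_star (f : cp) : cp_set f -> Phi (sa_star f) = sa_star (Phi f).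
Proof.
move=> [_ _ finv]; apply/funext => -[x g] /=; rewrite /cp_star.
have -> : alpha act (rep (cls g)) (f (cls (rep (cls g))^-1%g)) x =
    f (cls g^-1%g) (act x g).
  have [k kG ->] := rep_cls Gam g.
  by rewrite invgM finv ?gpredV// /alpha -ractM mulgK.
rewrite [RHS]rmorphM [LHS]mulrA; congr (_ * _).
rewrite [RHS]conjc_real -rmorphM; congr (_%:C).
rewrite !DeltaV// Delta_rep_cls sqrtrV ?ltW ?Delta_gt0//.
have d0 : Num.sqrt (Delta g) != 0 by rewrite gt_eqF// sqrtr_gt0 Delta_gt0.
rewrite -{2}[Delta g]sqr_sqrtr ?ltW ?Delta_gt0//.
by rewrite expr2 invfM mulrA divff// mul1r.
Qed.

Lemma lln_setD (F1 F2 : lln) : lln_set F1 -> lln_set F2 -> lln_set (sa_add F1 F2).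
Proof.
move=> [inv1 fin1] [inv2 fin2]; split.
  by move=> z w zw /=; rewrite (inv1 _ _ zw) (inv2 _ _ zw).
have : finite_set ([set dorb z | z in [set z | F1 z != 0]] `|`
                   [set dorb z | z in [set z | F2 z != 0]]).
  by rewrite finite_setU.
apply: sub_finite_set => _ [z /= + <-].
have [F1z|] := eqVneq (F1 z) 0; last by left; exists z.
by rewrite F1z add0r; right; exists z.
Qed.

Lemma lln_setZ c (F : lln) : lln_set F -> lln_set (sa_scale c F).
Proof.
move=> [Finv finF]; split; first by move=> z w zw /=; rewrite (Finv _ _ zw).
apply: sub_finite_set finF => _ [z /= + <-].
by rewrite mulf_eq0 negb_or => /andP[_ Fz]; exists z.
Qed.

Lemma lln_set_star (F : lln) : lln_set F -> lln_set (sa_star F).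
Proof.
move=> [Finv finF]; pose flip (z : X * G) := (act z.1 z.2, z.2^-1%g).
have flip_dorb z w : dorb z w -> dorb (flip z) (flip w).
  case: z w => x g [y h] /dorbP[k [l [kG lG -> ->]]]; apply/dorbP.
  by exists l, k; split=> //=; [rewrite -!ractM; group_nf|group_nf].
have flipK z : flip (flip z) = z.
  by case: z => x g; rewrite /flip /= invgK -ractM mulgV ract1.
have starE z : sa_star F z = ((F (flip z))^*)%R by case: z.
split; first by move=> z w zw; rewrite !starE (Finv (flip z))//; exact: flip_dorb.
pose A := [set z | F z != 0].
apply: (@finite_image_factor _ _ _ _ (fun z => dorb (flip z))).
  by move=> z w _ _ /dorb_eqP/flip_dorb; rewrite !flipK => /dorb_eqP.
apply: sub_finite_set finF => _ [z Fz <-]; exists (flip z) => //.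
by move: Fz; rewrite -[_ z]/(is_true (sa_star F z != 0)) starE conjC_eq0.
Qed.

(** If [(F1 * F2)(x, g) <> 0] then [(x, g)] lies in the orbit of some
    [(x1, g1 k g2)] with [k] in [Gamma], where [(x1, g1)] and [(x2, g2)] come from
    finite sets of representatives of the supports; [k g2] runs through finitely
    many left cosets. *)
Lemma lln_set_mul (F1 F2 : lln) : lln_set F1 -> lln_set F2 -> lln_set (sa_mul F1 F2).
Proof.
move=> [inv1 fin1] [inv2 fin2]; split.
  move=> [x g] [_ _] /dorbP[k [l [kG lG -> ->]]] /=.
  rewrite [RHS](reindex_fsbigT (@ltrans _ Gam k)); last exact: ltrans_bij.
  apply: eq_fsbigr => p _; rewrite /ltrans.
  have [m mG ->] := rep_cls Gam (k * rep p)%g; congr (_ * _).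
    apply: inv1; apply/dorbP; exists k, m^-1%g; split=> //; rewrite ?gpredV//.
    by group_nf.
  apply: inv2; apply/dorbP; exists m^-1%g, l; split=> //; rewrite ?gpredV//.
    by rewrite -!ractM; group_nf.
  by group_nf.
have [P1 [finP1 P1F]] := finite_dorbP fin1.
have [P2 [finP2 P2F]] := finite_dorbP fin2.
apply: (@sub_finite_set _ _ (\bigcup_(z in P1) \bigcup_(w in P2)
  (fun k => dorb (z.1, z.2 * (k * w.2))%g) @` [set` Gam])); last first.
  apply: bigcup_finite => // z _; apply: bigcup_finite => // w _.
  apply: finite_image_factor (finite_cls_double w.2 hecke) => k l _ _ /cls_eqP kl.
  apply/dorb_eqP/dorbP; exists 1%g, ((k * w.2)^-1 * (l * w.2))%g.
  by split; rewrite ?gpred1 ?ract1//; group_nf.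
move=> _ [[x g] /= Fxg <-].
have [p [F1p F2p]] : exists p, F1 (x, rep p) != 0 /\
    F2 (act x (rep p), (rep p)^-1 * g)%g != 0.
  apply/not_existsP => F0; move: Fxg; rewrite fsbig1 ?eqxx// => p _.
  apply/eqP; rewrite mulf_eq0; apply/negPn/negP; rewrite negb_or => /andP.
  exact: F0.
have [[x1 g1] Pz /dorbP[k [l [kG lG xE pE]]]] := P1F _ F1p.
have [[x2 g2] Pw /dorbP[k' [l' [kG' lG' _ gE]]]] := P2F _ F2p.
exists (x1, g1) => //; exists (x2, g2) => //; exists (l * k'^-1)%g => /=.
  by rewrite gpredM ?gpredV.
apply/dorb_eqP/dorbP; exists k, l'; split=> //.
by rewrite -[LHS](mulVKg (rep p)) gE pE; group_nf.
Qed.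

Lemma Phi_star_iso : star_iso Phi.
Proof.
split; [exact: Phi_bij|by move=> *; exact: Phi_add|by move=> *; exact: Phi_scale|
  by move=> *; exact: Phi_mul|exact: Phi_star].
Qed.

End AlgebraicIsomorphism.

(** * The one-dimensional Hilbert space *)

Section ComplexHilbert.
Variable R : realType.
Implicit Types z w : R[i].

Lemma normc_ge_Im z : `|complex.Im z|%:C <= `|z|.
Proof.
by rewrite normc_def lecR -sqrtr_sqr ler_wsqrtr// lerDr sqr_ge0.
Qed.

Lemma normc_le_ReIm z : `|z| <= (`|complex.Re z| + `|complex.Im z|)%:C.
Proof.
rewrite [z in leLHS]complexE (le_trans (ler_normD _ _))// rmorphD/= normrM.
by rewrite !normc_def /= !expr0n /= !addr0 add0r expr1n sqrtr1 mul1r !sqrtr_sqr.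
Qed.

Lemma complex_gt0E (e : R[i]) : 0 < e -> exists2 r : R, 0 < r & e = r%:C.
Proof.
case: e => a b; rewrite ltcE /= => /andP[/eqP-> a0]; by exists a.
Qed.

(** A Cauchy filter converges as soon as its real and imaginary parts do. *)
Lemma complex_complete (F : set_system R[i]^o) :
  ProperFilter F -> cauchy F -> cvg F.
Proof.
move=> FF /cauchyP Fc.
have part (p : R[i] -> R) : (forall z w, p (z - w) = p z - p w) ->
    (forall z, `|p z|%:C <= `|z|) -> exists a : R, p @ F --> a.
  move=> pB p_le; suff /cauchy_cvg/cvg_ex[a pa] : cauchy (p @ F) by exists a.
  apply/cauchy_exP => e e0.
  have [|z Fz] := Fc (e%:C); first by rewrite ltcR.
  exists (p z); rewrite nbhs_simpl /=; apply: filterS Fz => w zw /=.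
  have : `|z - w| < e%:C := zw.
  rewrite -[ball _ _ _]/(is_true (`|p z - p w| < e)) -ltcR -pB.
  exact/le_lt_trans/p_le.
have [a Fa] := part (@complex.Re R) (fun z w => raddfB _ z w) (@normc_ge_Re R).
have [b Fb] := part (@complex.Im R) (fun z w => raddfB _ z w) normc_ge_Im.
apply/cvg_ex; exists (a +i* b); apply/cvgrPdist_lt => _ /complex_gt0E[e e0 ->].
have e2 : 0 < e / 2 by rewrite divr_gt0.
near=> z; apply: le_lt_trans (normc_le_ReIm _) _.
rewrite ltcR (splitr e) ltrD//.
  have : `|a - complex.Re z| < e / 2 by near: z; exact: (cvgrPdist_lt _ _).1 Fa _ e2.
  by rewrite raddfB.
have : `|b - complex.Im z| < e / 2 by near: z; exact: (cvgrPdist_lt _ _).1 Fb _ e2.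
by rewrite raddfB.
Unshelve. all: by end_near. Qed.

(** A copy of the regular module [R[i]^o], to carry the completeness instance. *)
Definition complex_line : Type := R[i]^o.
HB.instance Definition _ := NormedModule.on complex_line.
HB.instance Definition _ := Uniform_isComplete.Build complex_line complex_complete.


Definition complex_dot (z w : complex_line) : R[i] := z * (w^*)%R.

Lemma complex_dot_bilinear :
  bilinear_for (GRing.Scale.Law.clone _ _ *%R _)
    (GRing.Scale.Law.clone _ _ (@Num.conj R[i] \; *%R) _) complex_dot.
Proof.
split=> [w|z] a u v; rewrite /complex_dot.
  by rewrite mulrDl; congr (_ + _); exact/esym/mulrA.
rewrite rmorphD mulrDr; congr (_ + _) => /=.
by rewrite [((a *: u)^*)%R]rmorphM mulrCA.
Qed.

HB.instance Definition _ := bilinear_isBilinear.Build R[i] complex_line complex_line R[i]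
  _ _ complex_dot complex_dot_bilinear.

Lemma complex_dot_hermitian (z w : complex_line) :
  complex_dot z w = (-1) ^+ false * ((complex_dot w z)^*)%R.
Proof. by rewrite /complex_dot mul1r rmorphM /= conjCK mulrC. Qed.

HB.instance Definition _ := isHermitianSesquilinear.Build R[i] complex_line false
  (@Num.conj R[i]) complex_dot complex_dot_hermitian.

Lemma complex_dot_gt0 (z : complex_line) : z != 0 -> 0 < complex_dot z z.
Proof. by move=> z0; rewrite /complex_dot -normCK exprn_gt0// normr_gt0. Qed.

HB.instance Definition _ := isDotProduct.Build R[i] complex_line complex_dot
  complex_dot_gt0.

Lemma complex_dotE (z : complex_line) : `|z| ^+ 2 = complex_dot z z.
Proof. exact: normCK. Qed.

Definition complex_hilbert : hilbert R :=
  @Hilbert R (complex_line : completeNormedModType R[i])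
    (complex_dot : {dot complex_line for (@Num.conj R[i])}) complex_dotE.

End ComplexHilbert.

(** * Evaluations are representations *)

Section DiagonalAlgebra.
Variables (R : realType) (G : groupType) (Gam : groupClosed G).
Variables (X : Type) (act : raction X G).
Implicit Types (a b : X -> R[i]) (H : set G).

Local Notation D := (@D_r R G Gam X act).

Lemma D_r_Cc H a : inter_conj Gam H -> Cc act H a -> D a.
Proof. by move=> HC aH M [_]; apply; exists H. Qed.

Lemma D_r0 : D (fun=> 0).
Proof. by move=> M [[[]]]. Qed.

Lemma D_rD a b : D a -> D b -> D (fun x => a x + b x).
Proof.
move=> Da Db M MD; have [[_ + _ _ _] _] := MD.
by apply; [exact: Da|exact: Db].
Qed.

Lemma D_rZ (z : R[i]) a : D a -> D (fun x => z * a x).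
Proof. by move=> Da M MD; have [[_ _ + _ _] _] := MD; apply; exact: Da. Qed.

Lemma D_rM a b : D a -> D b -> D (fun x => a x * b x).
Proof.
move=> Da Db M MD; have [[_ _ _ [+ _] _] _] := MD.
by apply; [exact: Da|exact: Db].
Qed.

Lemma D_r_conj a : D a -> D (fun x => (a x)^*)%R.
Proof. by move=> Da M MD; have [[_ _ _ [_ +] _] _] := MD; apply; exact: Da. Qed.

Lemma inter_conj_group : inter_conj Gam [set` Gam].
Proof.
exists [:: 1%g] => //; apply/seteqP; split=> h.
  by move=> hG g /=; rewrite inE => /eqP ->; apply/conj_subP; group_nf.
by move=> /(_ 1%g); rewrite /= inE => /(_ (eqxx _))/conj_subP; group_nf.
Qed.

(** The indicator of the [Gamma]-orbit of [x]; it makes evaluation at [x]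
    nondegenerate. *)
Lemma D_r_separates x : exists2 a, D a & a x = 1.
Proof.
pose O := orb act [set` Gam] x.
exists (fun y => (`[< O y >])%:R); last first.
  by rewrite asboolT//; exists 1%g; [exact: gpred1|exact: ract1].
apply: (D_r_Cc inter_conj_group); split.
  move=> y k kG; congr (nat_of_bool _)%:R; apply: asbool_equiv_eq; split.
    move=> [l lG lE]; exists (l * k^-1)%g; first by rewrite /= gpredM ?gpredV.
    by rewrite ractM lE -ractM mulgV ract1.
  by move=> [l lG <-]; exists (l * k)%g; [exact: gpredM|rewrite ractM].
apply: (@sub_finite_set _ _ [set O]); last exact: finite_set1.
move=> _ [y /= + <-]; case: asboolP => [[k kG <-] _|]; last by rewrite eqxx.
exact: orb_act (subgroup_set_group Gam) kG.
Qed.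

Lemma ev_rep x :
  nondegenerate_rep D (ev x : (X -> R[i]) -> complex_hilbert R -> complex_hilbert R).
Proof.
split.
  split.
  - move=> a _; split; first by move=> z u v; rewrite /ev mulrDr; congr (_ + _); exact: mulrCA.
    exists (complex.Re `|a x|) => xi; rewrite /ev normrM RRe_real// normr_real//.
  - by move=> a b xi _ _; exact: mulrDl.
  - by move=> z a xi _; exact/esym/mulrA.
  - by move=> a b xi _ _; exact/esym/mulrA.
  - move=> a xi eta _; rewrite /ev /= /complex_dot.
    by rewrite rmorphM /= conjCK mulrCA mulrA.
apply/seteqP; split=> // zeta _; apply: subset_closure.
have [a Da a1] := D_r_separates x.
exists 1%N, (fun=> a), (fun=> zeta); split=> //.
by rewrite big_ord1 /ev a1 mul1r.
Qed.

Lemma lln_rep_Phi x (f : cosets Gam -> X -> R[i]) (v : cosets Gam -> R[i]) :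
  lln_rep act x (@Phi R G Gam X act f) v = cp_rep act (ev x) f v.
Proof. by apply/funext => q; apply: eq_fsbigr => p _ /=; exact/esym/mulrA. Qed.

(** Each [pi_x] occurs among the representations defining the norm of the
    crossed product, as the one induced by [ev x]. *)
Lemma lln_norm_le_cp_norm (f : crossed_product R Gam act) :
  (lln_norm (Phi f) <= cp_norm f)%E.
Proof.
apply: ge_ereal_sup => _ [->|[x _ <-]]; apply: ereal_sup_ubound; first by left.
right; exists (complex_hilbert R), (ev x); split; first exact: ev_rep.
by congr opnorm; apply/funext => v; exact: lln_rep_Phi.
Qed.

End DiagonalAlgebra.

(** * Matrices over a Hilbert space *)

Section Amplification.
Variables (C : numClosedFieldType) (V : lmodType C).
Variable dot : {dot V for (@Num.conj C)}.

(** Cholesky factorisation of a Gram matrix, by Gram-Schmidt: one index of the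
    support at a time is made orthogonal to the others. *)
Lemma gram_factor (I : eqType) (s : seq I) (w : I -> V) :
  (forall i, i \notin s -> w i = 0) ->
  exists cs : seq (I -> C),
    forall i j, dot (w i) (w j) = \sum_(c <- cs) c i * (c j)^*.
Proof.
elim: s w => [|i0 s IH] w w0.
  by exists [::] => i j; rewrite big_nil w0// linear0l.
have [wi0|wi0] := eqVneq (w i0) 0.
  apply: IH => i si; have [->//|ii0] := eqVneq i i0.
  by apply: w0; rewrite inE negb_or ii0.
set d := dot (w i0) (w i0).
have d0 : 0 < d by exact: neq0_dnorm_gt0.
have dJ : d^* = d by apply/CrealP; rewrite ger0_real// ltW.
have hC u v : (dot u v)^* = dot v u.
  by rewrite [RHS]hermitian_subproof expr0 mul1r.
pose w' i := w i - (dot (w i) (w i0) / d) *: w i0.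
have [i si|cs csP] := IH w'.
  rewrite /w'; have [->|ii0] := eqVneq i i0; first by rewrite divff ?gt_eqF// scale1r subrr.
  by rewrite (w0 i) ?inE ?negb_or ?ii0// linear0l mul0r scale0r subrr.
exists ((fun i => dot (w i) (w i0) / sqrtC d) :: cs) => i j.
rewrite big_cons -csP /w' linearBl !linearBr/= !linearZl_LR/= !linearZr_LR/=.
rewrite -/d !rmorphM !fmorphV /= dJ !hC.
rewrite (conj_Creal (sqrtC_real _)) ?ltW// -![_ *: _]/(_ * _).
have r0 : sqrtC d != 0 by rewrite sqrtC_eq0 gt_eqF.
have dE : sqrtC d * sqrtC d = d by rewrite -expr2 sqrtCK.
by move: (sqrtC d) r0 dE => r r0 <-; field.
Qed.

(** The bound of a scalar matrix persists on families of vectors: by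
    [gram_factor] the Gram matrix of the family is a sum of rank one matrices,
    and the scalar bound applies to each of them. *)
Lemma amplification (I J : eqType) (sI : seq I) (sJ : seq J) (A : J -> I -> C) (K : C) :
  (forall c : I -> C,
     \sum_(q <- sJ) `|\sum_(p <- sI) A q p * c p| ^+ 2 <= K * \sum_(p <- sI) `|c p| ^+ 2) ->
  forall w : I -> V,
    \sum_(q <- sJ) dot (\sum_(p <- sI) A q p *: w p) (\sum_(p <- sI) A q p *: w p)
      <= K * \sum_(p <- sI) dot (w p) (w p).
Proof.
move=> AK w0; pose w i := if i \in sI then w0 i else 0.
have [i /negPf ->//|cs csP] := @gram_factor _ sI (fun i => if i \in sI then w0 i else 0).
have dotA q : dot (\sum_(p <- sI) A q p *: w0 p) (\sum_(p <- sI) A q p *: w0 p) =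
    \sum_(c <- cs) `|\sum_(p <- sI) A q p * c p| ^+ 2.
  have -> : \sum_(p <- sI) A q p *: w0 p = \sum_(p <- sI) A q p *: w p.
    by apply: eq_big_seq => p sp; rewrite /w sp.
  rewrite linear_sumlz; under eq_bigr do rewrite linear_sumr.
  under eq_bigr do under eq_bigr do
    rewrite /= linearZl_LR linearZr_LR/= csP !mulr_sumr.
  rewrite [RHS](eq_bigr (fun c : I -> C => \sum_(i <- sI) \sum_(j <- sI)
      A q i * ((A q j)^* * (c i * (c j)^*)))); last first.
    move=> c _; rewrite normCK rmorph_sum mulr_suml; apply: eq_bigr => i _.
    rewrite mulr_sumr; apply: eq_bigr => j _ /=.
    by rewrite rmorphM mulrACA [RHS]mulrA.
  rewrite [RHS]exchange_big/=; apply: eq_bigr => i _.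
  by rewrite exchange_big.
have dotw : \sum_(p <- sI) dot (w0 p) (w0 p) =
    \sum_(c <- cs) \sum_(p <- sI) `|c p| ^+ 2.
  rewrite exchange_big/=; apply: eq_big_seq => p sp.
  by have := csP p p; rewrite sp => ->; apply: eq_bigr => c _; rewrite normCK.
rewrite dotw (eq_bigr _ (fun q _ => dotA q)) exchange_big/= mulr_sumr.
by apply: ler_sum => c _; exact: AK.
Qed.

End Amplification.

(** * Joint level sets *)

Section LevelSets.
Variables (R : realType) (G : groupType) (Gam : groupClosed G).
Variables (X : Type) (act : raction X G).
Implicit Types (a b : X -> R[i]) (H : set G).

Local Notation D := (@D_r R G Gam X act).

Definition inter_conj_Cc a := exists2 H, inter_conj Gam H & Cc act H a.

Lemma subgroup_set_inter_conj H : inter_conj Gam H -> subgroup_set H.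
Proof.
move=> [s _ ->]; split=> [g gs|h k hH kH g gs].
  by apply/conj_subP; group_nf; exact: gpred1.
by apply: (subgroup_set_conj Gam g).2; [exact: hH|exact: kH].
Qed.

Lemma inter_conj_Cc_comp (phi : R[i] -> R[i]) a : phi 0 = 0 ->
  inter_conj_Cc a -> inter_conj_Cc (phi \o a).
Proof.
move=> phi0 [H HC [aH afin]]; exists H => //; split=> [x h hH /=|].
  by rewrite aH.
apply: sub_finite_set afin => _ [x /= + <-]; have [->|ax0 _] := eqVneq (a x) 0.
  by rewrite phi0 eqxx.
by exists x.
Qed.

Lemma inter_conj_Cc_D_r a : inter_conj_Cc a -> D a.
Proof. by move=> [H HC aH]; exact: D_r_Cc aH. Qed.

Lemma inter_conj_Cc_finite_range a : inter_conj_Cc a -> finite_set (range a).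
Proof.
move=> [H /subgroup_set_inter_conj sH [aH afin]].
have : finite_set ([set 0] `|` a @` [set x | a x != 0]).
  rewrite finite_setU; split; first exact: finite_set1.
  apply: finite_image_factor afin => x y _ _ xy.
  have : orb act H x x by exists 1%g; [exact: sH.1|exact: ract1].
  by rewrite xy => -[h hH <-]; rewrite aH.
apply: sub_finite_set => _ [x _ <-].
by have [->|ax0] := eqVneq (a x) 0; [left|right; exists x].
Qed.

Variables (E : choiceType) (a : E -> X -> R[i]).

(** Cut off outside [es], so that only finitely many functions of [E] arise when
    [x] varies. *)
Definition joint_value (es : seq E) (x : X) : E -> R[i] :=
  fun e => if e \in es then a e x else 0.

Lemma finite_joint_value es : (forall e, e \in es -> inter_conj_Cc (a e)) ->
  finite_set (range (joint_value es)).
Proof.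
elim: es => [|e0 es IH] aC.
  apply: (@sub_finite_set _ _ [set fun=> 0]); last exact: finite_set1.
  by move=> _ [x _ <-].
pose upd (z : E -> R[i]) (c : R[i]) : E -> R[i] := fun e => if e == e0 then c else z e.
have -> : range (joint_value (e0 :: es)) =
    [set upd (joint_value es x) (a e0 x) | x in [set: X]].
  apply: eq_imagel => x _; apply/funext => e; rewrite /upd /joint_value inE.
  by case: eqVneq => [->|].
apply: finite_image11; last first.
  by apply: inter_conj_Cc_finite_range; apply: aC; rewrite mem_head.
by apply: IH => e es_e; apply: aC; rewrite inE es_e orbT.
Qed.

Definition level_ind (es : seq E) (z : E -> R[i]) : X -> R[i] :=
  fun x => (joint_value es x == z)%:R.

(** The set where [a e] takes the value [c] has its indicator in [C_c(X / H)]
    when [c != 0]; for [c = 0] its complement does.  A level set of a non-zero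
    joint value is therefore obtained by intersections and differences starting
    from a set of the first kind. *)
Lemma level_ind_D_r es z x0 : (forall e, e \in es -> inter_conj_Cc (a e)) ->
  joint_value es x0 = z -> z <> (fun=> 0) -> D (level_ind es z).
Proof.
move=> aC x0z z0.
have [e0 ze0] : exists e0, z e0 != 0.
  apply/not_existsP => zz; apply: z0; apply/funext => e.
  exact/eqP/negPn/negP/zz.
have e0s : e0 \in es.
  by move: ze0; rewrite -x0z /joint_value; case: ifP => //; rewrite eqxx.
pose u t : X -> R[i] := fun x => ((a e0 x == z e0) && all (fun e => a e x == z e) t)%:R.
have uD t : {subset t <= es} -> D (u t).
  elim: t => [|e t IH] ts.
    apply: inter_conj_Cc_D_r; have -> : u [::] = (fun c => (c == z e0)%:R) \o a e0.
      by apply/funext => x; rewrite /u/= andbT.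
    by apply: inter_conj_Cc_comp; [rewrite eq_sym (negPf ze0)|exact: aC].
  have es_e : e \in es by apply: ts; rewrite mem_head.
  have ut : D (u t) by apply: IH => e' te'; apply: ts; rewrite inE te' orbT.
  have [ze|ze] := eqVneq (z e) 0.
    have -> : u (e :: t) =
        fun x => u t x + -1 * (u t x * ((fun c => (c != 0)%:R) \o a e) x).
      apply/funext => x; rewrite /u/= ze andbCA; case: (a e x == 0) => /=.
        by rewrite mulr0 mulr0 addr0.
      by rewrite mulr1 mulN1r subrr.
    apply: D_rD => //; apply: D_rZ; apply: D_rM => //; apply: inter_conj_Cc_D_r.
    by apply: inter_conj_Cc_comp; [rewrite eqxx|exact: aC].
  have -> : u (e :: t) = fun x => u t x * ((fun c => (c == z e)%:R) \o a e) x.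
    by apply/funext => x; rewrite /u/= andbCA -natrM mulnb andbC.
  apply: D_rM => //; apply: inter_conj_Cc_D_r.
  by apply: inter_conj_Cc_comp; [rewrite eq_sym (negPf ze)|exact: aC].
suff -> : level_ind es z = u es by exact: uD.
apply/funext => x; congr (nat_of_bool _)%:R; apply/eqP/andP.
  move=> xz; have az e : e \in es -> a e x == z e.
    by rewrite -xz /joint_value => ->.
  by split; [exact: az|apply/allP => e; exact: az].
move=> [_ /allP az]; apply/funext => e; rewrite /joint_value.
case: ifPn => [/az/eqP//|/negPf es_e].
by rewrite -x0z /joint_value es_e.
Qed.

(** The functions indexed by [es] are simultaneously diagonalised: they are
    combinations of the mutually orthogonal indicators of the joint level sets. *)
Lemma level_decomposition es : (forall e, e \in es -> inter_conj_Cc (a e)) ->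
  exists zs : seq (E -> R[i]), [/\ uniq zs,
    forall z, z \in zs -> exists x, joint_value es x = z,
    forall z, z \in zs -> D (level_ind es z) &
    forall e, e \in es ->
      a e = fun x => \sum_(z <- zs) z e * level_ind es z x].
Proof.
move=> aC; have fin := finite_joint_value aC.
pose zs : seq (E -> R[i]) :=
  [seq z <- fset_set (range (joint_value es)) | z != (fun=> 0)].
have zsP z : z \in zs <-> z != (fun=> 0) /\ exists x, joint_value es x = z.
  rewrite mem_filter (in_fset_set fin); split=> [/andP[z0 /set_mem[x _ xz]]|].
    by split=> //; exists x.
  by move=> [-> [x xz]]; apply: mem_set; exists x.
exists zs; split.
- by rewrite filter_uniq// fset_uniq.
- by move=> z /zsP[].
- by move=> z /zsP[/eqP z0 [x xz]]; exact: level_ind_D_r aC xz z0.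
- move=> e es_e; apply/funext => x.
  have xe : joint_value es x e = a e x by rewrite /joint_value es_e.
  have xz z : z != joint_value es x -> z e * level_ind es z x = 0.
    by rewrite eq_sym /level_ind => /negPf ->; rewrite mulr0.
  have [x0|x0] := eqVneq (joint_value es x) (fun=> 0).
    rewrite -xe {1}x0 big1_seq// => z /= /zsP[z0 _].
    by apply: xz; rewrite x0.
  have zx : joint_value es x \in zs.
    by apply/zsP; split=> //; exists x.
  rewrite (bigD1_seq _ zx) ?filter_uniq ?fset_uniq//= big1 => [|z]; last exact: xz.
  by rewrite /level_ind eqxx mulr1 xe addr0.
Qed.

End LevelSets.

(** * Representations of the diagonal algebra contract matrices *)

Section Contraction.
Variables (R : realType) (G : groupType) (Gam : groupClosed G).
Variables (X : Type) (act : raction X G).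
Variables (H : hilbert R) (pi : (X -> R[i]) -> H -> H).

Local Notation D := (@D_r R G Gam X act).
Local Notation dot := (hdot H).

Hypothesis pi_rep : star_rep D pi.

Lemma dotC (u v : H) : (dot u v)^* = dot v u.
Proof. by rewrite [RHS]hermitian_subproof expr0 mul1r. Qed.

Lemma pythagoras (T : eqType) (ts : seq T) (u : T -> H) : uniq ts ->
  (forall s t, s \in ts -> t \in ts -> s != t -> dot (u s) (u t) = 0) ->
  dot (\sum_(t <- ts) u t) (\sum_(t <- ts) u t) = \sum_(t <- ts) dot (u t) (u t).
Proof.
move=> uts ort; rewrite linear_sumlz; apply: eq_big_seq => s ss.
rewrite linear_sumr (bigD1_seq s)//= big1_seq ?addr0// => t /andP[ts_ tts].
by apply: ort => //; rewrite eq_sym.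
Qed.

Lemma rep0 xi : pi (fun=> 0) xi = 0.
Proof.
have [_ _ piZ _ _] := pi_rep.
have -> : (fun=> 0) = (fun x : X => 0 * (fun=> 0) x) :> (X -> R[i]).
  by apply/funext => x; rewrite mul0r.
by rewrite piZ ?scale0r//; exact: D_r0.
Qed.

Lemma rep_sum (T : eqType) (ts : seq T) (c : T -> R[i]) (u : T -> X -> R[i]) xi :
  (forall t, t \in ts -> D (u t)) ->
  D (fun x => \sum_(t <- ts) c t * u t x) /\
  pi (fun x => \sum_(t <- ts) c t * u t x) xi = \sum_(t <- ts) c t *: pi (u t) xi.
Proof.
have [_ piD piZ _ _] := pi_rep.
elim: ts => [|t ts IH] uD.
  have -> : (fun x => \sum_(t <- [::]) c t * u t x) = (fun=> 0).
    by apply/funext => x; rewrite big_nil.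
  by rewrite big_nil rep0; split=> //; exact: D_r0.
have [|Ds piS] := IH; first by move=> s sts; apply: uD; rewrite inE sts orbT.
have Dt : D (u t) by apply: uD; rewrite mem_head.
have -> : (fun x => \sum_(t <- t :: ts) c t * u t x) =
    (fun x => c t * u t x + \sum_(t <- ts) c t * u t x).
  by apply/funext => x; rewrite big_cons.
have Dct := D_rZ (c t) Dt.
split; first exact: D_rD.
by rewrite piD// piZ// piS big_cons.
Qed.

Variables (E : choiceType) (a : E -> X -> R[i]) (es : seq E).

(** The indicators of the joint level sets are represented by mutually
    orthogonal projections. *)
Lemma dot_level z z' xi eta : D (level_ind a es z) -> D (level_ind a es z') ->
  dot (pi (level_ind a es z) xi) (pi (level_ind a es z') eta) =
  if z == z' then dot xi (pi (level_ind a es z) eta) else 0.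
Proof.
have [_ _ _ piM piJ] := pi_rep; move=> Dz Dz'.
rewrite piJ// -piM//; last exact: D_r_conj.
have -> : (fun x => (level_ind a es z x)^* * level_ind a es z' x) =
    if z == z' then level_ind a es z else fun=> 0.
  apply/funext => x; rewrite /level_ind conjC_nat -natrM mulnb.
  case: (eqVneq z z') => [->|zz']; first by rewrite andbb.
  by case: eqVneq => // ->; rewrite (negPf zz').
by case: eqVneq => // _; rewrite rep0 linear0r.
Qed.

(** The squared distance from [v] to the sum of its projections is nonnegative. *)
Lemma bessel zs v : uniq zs -> (forall z, z \in zs -> D (level_ind a es z)) ->
  \sum_(z <- zs) dot (pi (level_ind a es z) v) (pi (level_ind a es z) v) <= dot v v.
Proof.
move=> uzs Dz; set S := (leLHS).
have S0 : S^* = S.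
  by rewrite /S rmorph_sum; apply: eq_bigr => z _; exact: dotC.
pose s := \sum_(z <- zs) pi (level_ind a es z) v.
have ss : dot s s = S.
  apply: pythagoras => // z z' zzs zzs' zz'.
  by rewrite dot_level ?(negPf zz')//; exact: Dz.
have vs : dot v s = S.
  rewrite linear_sumr; apply: eq_big_seq => z zzs.
  by rewrite dot_level ?eqxx//; exact: Dz.
have := dnorm_ge0 dot (v - s).
by rewrite dnormB ss vs S0 opprD addrA addrK subr_ge0.
Qed.

End Contraction.

Section MatrixContraction.
Variables (R : realType) (G : groupType) (Gam : groupClosed G).
Variables (X : Type) (act : raction X G).
Variables (H : hilbert R) (pi : (X -> R[i]) -> H -> H).

Local Notation D := (@D_r R G Gam X act).
Local Notation dot := (hdot H).

(** On the range of the projection of a joint level set the matrix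
    [pi (a q p)] acts as the scalar matrix [z (q, p)] of values of [a] there,
    tensored with the identity. *)
Lemma rep_matrix_contraction (I J : choiceType) (sI : seq I) (sJ : seq J)
    (a : J * I -> X -> R[i]) (K : R[i]) : star_rep D pi -> 0 <= K ->
  (forall q p, q \in sJ -> p \in sI -> inter_conj_Cc Gam act (a (q, p))) ->
  (forall x c, \sum_(q <- sJ) `|\sum_(p <- sI) a (q, p) x * c p| ^+ 2 <=
     K * \sum_(p <- sI) `|c p| ^+ 2) ->
  forall v : I -> H,
    \sum_(q <- sJ) dot (\sum_(p <- sI) pi (a (q, p)) (v p))
                       (\sum_(p <- sI) pi (a (q, p)) (v p)) <=
    K * \sum_(p <- sI) dot (v p) (v p).
Proof.
move=> pi_rep K0 aC aK v; pose es := [seq (q, p) | q <- sJ, p <- sI].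
have esP q p : q \in sJ -> p \in sI -> (q, p) \in es.
  by move=> qJ pI; apply/allpairsP; exists (q, p).
have [|zs [uzs zx zD aE]] := @level_decomposition R G Gam X act _ a es.
  by move=> _ /allpairsP[[q p] /= [qJ pI ->]]; exact: aC.
pose P z := pi (level_ind a es z).
pose u q z := \sum_(p <- sI) z (q, p) *: P z (v p).
have entry q : q \in sJ ->
    \sum_(p <- sI) pi (a (q, p)) (v p) = \sum_(z <- zs) u q z.
  move=> qJ; rewrite exchange_big/=; apply: eq_big_seq => p pI.
  by rewrite (aE _ (esP _ _ qJ pI)) (rep_sum pi_rep _ _ zD).2.
have -> : \sum_(q <- sJ) dot (\sum_(p <- sI) pi (a (q, p)) (v p))
      (\sum_(p <- sI) pi (a (q, p)) (v p)) =
    \sum_(z <- zs) \sum_(q <- sJ) dot (u q z) (u q z).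
  rewrite exchange_big/=; apply: eq_big_seq => q qJ; rewrite entry//.
  apply: pythagoras => // z z' zzs zzs' zz'.
  rewrite /u linear_sumlz big1// => p _; rewrite linear_sumr big1// => p' _.
  rewrite /= linearZl_LR linearZr_LR /= (dot_level pi_rep) ?(negPf zz') ?mulr0//;
    exact: zD.
apply: (@le_trans _ _ (K * \sum_(p <- sI) \sum_(z <- zs) dot (P z (v p)) (P z (v p)))).
  rewrite [in leRHS]exchange_big/= mulr_sumr big_seq [leRHS]big_seq.
  apply: ler_sum => z zzs.
  apply: (amplification dot (A := fun q p => z (q, p))) => c.
  have [x xz] := zx z zzs; apply: le_trans (aK x c).
  rewrite (@eq_big_seq _ _ _ _ _ _ (fun q => `|\sum_(p <- sI) a (q, p) x * c p| ^+ 2))//.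
  move=> q qJ; congr (`|_| ^+ 2); apply: eq_big_seq => p pI.
  by rewrite -xz /joint_value esP.
rewrite ler_wpM2l//; apply: ler_sum => p _; exact: (bessel pi_rep).
Qed.

End MatrixContraction.

(** * Operator norms *)

Section OperatorNorms.
Variables (R : realType) (I : choiceType).

Lemma l2norm_leP (V : normedZmodType R[i]) (v : I -> V) (M : R) : 0 <= M ->
  (l2norm v <= M%:E)%E <->
  (forall s : seq I, uniq s -> \sum_(i <- s) `|v i| ^+ 2 <= (M ^+ 2)%:C).
Proof.
move=> M0; rewrite /l2norm; set S := esum _ _.
have S0 : (0 <= S)%E by apply: esum_ge0 => i _; rewrite lee_fin sqr_ge0.
have SE : (S `^ 2^-1 <= M%:E)%E <-> (S <= (M ^+ 2)%:E)%E.
  split=> SM.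
    have := @gt0_ler_poweR R 2 (ler0n R 2) _ _ _ _ SM.
    rewrite -poweRrM mulVf ?pnatr_eq0// poweRe1// poweR_EFin powR_mulrn//.
    by apply; rewrite in_itv /= ?poweR_ge0 ?lee_fin ?M0 ?leey.
  have := @gt0_ler_poweR R 2^-1 _ _ _ _ _ SM.
  rewrite poweR_EFin powR12_sqrt ?sqr_ge0// sqrtr_sqr ger0_norm//.
  by apply; rewrite ?invr_ge0 ?in_itv /= ?S0 ?lee_fin ?sqr_ge0 ?leey.
rewrite SE.
have toC (s : seq I) : \sum_(i <- s) `|v i| ^+ 2 =
    (\sum_(i <- s) complex.Re `|v i| ^+ 2)%:C.
  rewrite rmorph_sum; apply: eq_bigr => i _.
  by rewrite /= rmorphXn/= RRe_real// normr_real.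
split=> [SM s us|vM].
  rewrite toC lecR -lee_fin -sumEFin; apply: le_trans SM; apply: esum_ge.
  exists [set` s]; first by split=> //; exact: finite_seq.
  by rewrite -fsbig_seq.
apply: ge_ereal_sup => _ [A [finA _] <-].
rewrite fsbig_finite// sumEFin lee_fin -lecR -toC.
by apply: vM; exact: fset_uniq.
Qed.

Lemma ler_sum_support (F : numDomainType) (s t : seq I) (g : I -> F) :
  uniq s -> uniq t -> (forall i, 0 <= g i) -> (forall i, i \notin s -> g i = 0) ->
  \sum_(i <- t) g i <= \sum_(i <- s) g i.
Proof.
move=> us ut g0 gs; rewrite (bigID (mem s))/= [X in _ + X]big1 ?addr0; last first.
  by move=> i; exact: gs.
rewrite [leRHS](bigID (mem t))/= -big_filter -[X in _ <= X + _]big_filter.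
rewrite (perm_big [seq i <- s | i \in t]); last first.
  apply: uniq_perm; rewrite ?filter_uniq// => i.
  by rewrite !mem_filter andbC.
by rewrite lerDl sumr_ge0.
Qed.

(** A bounded operator given by a matrix is bounded on finitely supported
    vectors by homogeneity; only unit vectors are mentioned in [opnorm]. *)
Lemma opnorm_matrix_bound (T : I -> I -> R[i]) (M : R) (s t : seq I) (c : I -> R[i]) :
  0 <= M -> uniq s -> uniq t ->
  (opnorm (fun (v : I -> R[i]) q => (\sum_(p \in [set: I]) T q p * v p)%R) <= M%:E)%E ->
  \sum_(q <- t) `|\sum_(p <- s) T q p * c p| ^+ 2 <=
    (M ^+ 2)%:C * \sum_(p <- s) `|c p| ^+ 2.
Proof.
move=> M0 us ut TM; set N := \sum_(p <- s) `|c p| ^+ 2.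
have N0 : 0 <= N by apply: sumr_ge0 => p _; rewrite exprn_ge0.
have [N00|Nn0] := eqVneq N 0.
  have c0 p : p \in s -> c p = 0.
    move=> ps; apply/eqP; rewrite -normr_eq0 -sqrf_eq0; apply/eqP.
    move: N00 => /eqP; rewrite psumr_eq0 => [|q _]; last exact: exprn_ge0.
    by move=> /allP/(_ p ps)/implyP/(_ isT)/eqP.
  rewrite N00 mulr0 big1// => q _; rewrite big1_seq ?normr0 ?expr0n// => p ps.
  by rewrite c0 ?mulr0.
have [r [r0 rN]] : exists r : R[i], 0 < r /\ r ^+ 2 = N.
  by exists (sqrtC N); rewrite sqrtCK sqrtC_gt0 lt_def Nn0.
pose v p := if p \in s then c p / r else 0.
have rr : `|r| = r by rewrite gtr0_norm.
have v1 : (l2norm v <= 1%:E)%E.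
  apply/l2norm_leP => // s' us'; rewrite expr1n.
  have <- : \sum_(p <- s) `|v p| ^+ 2 = 1%:C.
    rewrite (eq_big_seq (fun p => `|c p| ^+ 2 / N)) -?mulr_suml ?divff// => p ps.
    by rewrite /v ps normrM normfV rr expr_div_n rN.
  by apply: ler_sum_support => // i /negPf si;
    rewrite /v si normr0 expr0n.
have : (l2norm (fun q => (\sum_(p \in [set: I]) T q p * v p)%R) <= M%:E)%E.
  by apply: le_trans TM; apply: ereal_sup_ubound; exists v.
move=> /(l2norm_leP _ M0)/(_ t ut) TvM.
rewrite -ler_pdivrMr ?lt_def ?Nn0// -rN.
apply: le_trans TvM; rewrite mulr_suml; apply: ler_sum => q _.
have -> : \sum_(p \in [set: I]) T q p * v p = (\sum_(p <- s) T q p * c p) / r.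
  rewrite (@fsbigE _ _ _ _ setT s _ us)//; last first.
    by move=> p _ /negPf ps; rewrite /v ps mulr0.
  rewrite (eq_bigl xpredT) => [|p]; last by rewrite in_setT.
  by rewrite mulr_suml; apply: eq_big_seq => p ps; rewrite /v ps mulrA.
by rewrite normrM normfV rr expr_div_n.
Qed.

End OperatorNorms.

(** * Equality of the reduced norms *)

Section NormEquality.
Variables (R : realType) (G : groupType) (Gam : groupClosed G).
Variables (X : Type) (act : raction X G).
Implicit Types (g h k : G) (p q : cosets Gam) (x y : X).

Local Notation Delta := (Delta Gam R).
Local Notation cls := (cls Gam).
Local Notation cp := (crossed_product R Gam act).
Local Notation cp_set := (@cp_set R G Gam X act).
Local Notation D := (@D_r R G Gam X act).

Lemma alpha_Cc (K : set G) g (b : X -> R[i]) : subgroup_set K -> Cc act K b ->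
  Cc act [set h | K (g^-1 * h * g)%g] (alpha act g b).
Proof.
move=> sK [bK bfin]; set H := [set h | _].
have sH : subgroup_set H.
  split=> [|h k hH kH]; first by rewrite /H /= mulg1 mulVg; exact: sK.1.
  rewrite -[H _]/(K (g^-1 * (h^-1 * k) * g)%g).
  have -> : (g^-1 * (h^-1 * k) * g = (g^-1 * h * g)^-1 * (g^-1 * k * g))%g.
    by group_nf.
  exact: sK.2.
split=> [x h hH|].
  by rewrite /alpha -(bK (act x g) _ hH) -!ractM; group_nf.
apply: (@finite_image_factor _ _ _ _ (fun x => orb act K (act x g))).
  move=> x y _ _ xy; have : orb act K (act y g) (act y g).
    by exists 1%g; [exact: sK.1|exact: ract1].
  rewrite -xy => -[k kK xky]; have -> : y = act x (g * k * g^-1)%g.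
    by rewrite !ractM xky -ractM mulgV ract1.
  by apply/esym/orb_act => //; rewrite /H /=; group_nf.
by apply: sub_finite_set bfin => _ [x bx <-]; exists (act x g).
Qed.

(** The entry at [(q, p)] of the operator attached to [f], before [pi] is
    applied to it. *)
Definition coefficient (f : cp) (qp : cosets Gam * cosets Gam) : X -> R[i] :=
  let g := ((rep qp.1)^-1 * rep qp.2)%g in
  fun x => (Num.sqrt (Delta g))%:C * alpha act (rep qp.1) (f (cls g)) x.

(** For [f] in the crossed product, [q] translates [Gamma^(q^-1 p)] to the
    intersection of the conjugates of [Gamma] by [q] and [p]. *)
Lemma translate_Cc (f : cp) q p : cp_set f ->
  inter_conj_Cc Gam act (alpha act (rep q) (f (cls ((rep q)^-1 * rep p)%g))).
Proof.
move=> [_ fCc _]; have fg := fCc ((rep q)^-1 * rep p)%g.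
have sK := subgroup_setI (subgroup_set_group Gam)
  (subgroup_set_conj Gam ((rep q)^-1 * rep p)%g).
exists [set h | conj_cap Gam ((rep q)^-1 * rep p)%g ((rep q)^-1 * h * rep q)%g];
  last exact: alpha_Cc.
exists [:: rep q; rep p] => //; apply/seteqP; split=> h /=.
  move=> [hq /conj_subP]; group_nf => hp g; rewrite /= !inE => /orP[]/eqP->.
    exact/conj_subP.
  exact/conj_subP.
move=> hH; split; last apply/conj_subP; group_nf.
  by apply/conj_subP; apply: hH; rewrite /= mem_head.
by apply/conj_subP; apply: hH; rewrite /= !inE eqxx orbT.
Qed.

Lemma coefficient_Cc (f : cp) qp : cp_set f ->
  inter_conj_Cc Gam act (coefficient f qp).
Proof.
case: qp => q p /(translate_Cc q p).
by apply: (inter_conj_Cc_comp (phi := fun c => _ * c)); rewrite mulr0.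
Qed.

Lemma finite_row_support (f : cp) q : cp_set f ->
  finite_set [set p : cosets Gam | f (cls ((rep q)^-1 * rep p)%g) <> fun=> 0].
Proof.
move=> [finf _ _]; have := finite_image (@ltrans _ Gam (rep q)) finf.
apply: sub_finite_set => p /= fp; exists (ltrans (rep q)^-1%g p) => //.
by have := ltransK (rep q)^-1%g p; rewrite invgK.
Qed.

Lemma rep_coefficient (H : hilbert R) (pi : (X -> R[i]) -> H -> H) (f : cp)
    (v : cosets Gam -> H) q (s : seq (cosets Gam)) :
  star_rep D pi -> cp_set f -> uniq s ->
  (forall p, p \notin s -> f (cls ((rep q)^-1 * rep p)%g) = fun=> 0) ->
  cp_rep act pi f v q = \sum_(p <- s) pi (coefficient f (q, p)) (v p).
Proof.
move=> pi_rep sf us fs; rewrite /cp_rep (@fsbigE _ _ _ _ setT s _ us)//; last first.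
  move=> p _ /fs ->; have -> : alpha act (rep q) (fun=> 0) = (fun=> 0) by [].
  by rewrite (rep0 pi_rep) scaler0.
rewrite (eq_bigl xpredT) => [|p]; last by rewrite in_setT.
have [_ _ piZ _ _] := pi_rep.
apply: eq_bigr => p _; rewrite -piZ//; apply: inter_conj_Cc_D_r.
exact: translate_Cc.
Qed.

(** For finitely many rows [t] only the finitely many columns [s] contribute, and
    the block [t x s] is contracted by [pi]. *)
Lemma cp_norm_le_lln_norm (f : cp) : cp_set f -> (cp_norm f <= lln_norm (Phi f))%E.
Proof.
move=> sf; set B := lln_norm _.
have B0 : (0 <= B)%E by apply: ereal_sup_ubound; left.
have Bx x : (opnorm (@lln_rep R G Gam X act x (Phi f)) <= B)%E.
  by apply: ereal_sup_ubound; right; exists x.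
apply: ge_ereal_sup => _ [->|[H [pi [[pi_rep _] ->]]]]; first exact: B0.
case: B B0 Bx => [M|_ _|//]; last exact: leey.
rewrite lee_fin => M0 Bx; apply: ge_ereal_sup => _ [v /= v1 <-].
apply/l2norm_leP => // t ut.
pose S := \bigcup_(q in [set` t])
  [set p : cosets Gam | f (cls ((rep q)^-1 * rep p)%g) <> fun=> 0].
have finS : finite_set S.
  by apply: bigcup_finite => [|q _]; [exact: finite_seq|exact: finite_row_support].
pose s : seq (cosets Gam) := fset_set S.
have us : uniq s by exact: fset_uniq.
have row q : q \in t ->
    cp_rep act pi f v q = \sum_(p <- s) pi (coefficient f (q, p)) (v p).
  move=> qt; apply: rep_coefficient => // p ps; apply: contrapT => fp.
  by move/negP: ps; apply; rewrite (in_fset_set finS); apply/mem_set; exists q.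
rewrite (eq_big_seq (fun q =>
    hdot H (\sum_(p <- s) pi (coefficient f (q, p)) (v p))
           (\sum_(p <- s) pi (coefficient f (q, p)) (v p)))); last first.
  by move=> q qt; rewrite hdotE row.
have K0 : 0 <= (M ^+ 2)%:C by rewrite ler0c sqr_ge0.
have coefC q p : q \in t -> p \in s -> inter_conj_Cc Gam act (coefficient f (q, p)).
  by move=> _ _; exact: coefficient_Cc.
apply: le_trans (rep_matrix_contraction pi_rep K0 coefC _ v) _.
  by move=> x c; apply: opnorm_matrix_bound; last exact: Bx.
rewrite ler_piMr//; under eq_bigr do rewrite -hdotE.
by have /(l2norm_leP _ ler01)/(_ s us) := v1; rewrite expr1n.
Qed.

Lemma cp_norm_Phi (f : cp) : cp_set f -> lln_norm (Phi f) = cp_norm f.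
Proof.
by move=> sf; apply/eqP; rewrite eq_le lln_norm_le_cp_norm cp_norm_le_lln_norm.
Qed.

End NormEquality.

(** * Completions *)

Section CompletionMap.
Variables (R : realType) (A B : star_alg R[i]).
Variables (N : A -> \bar R) (N' : B -> \bar R) (phi : A -> B).

Hypothesis phi_iso : star_iso phi.
Hypothesis phi_norm : forall a, sa_set A a -> N' (phi a) = N a.
Hypothesis addA : forall a b, sa_set A a -> sa_set A b -> sa_set A (sa_add a b).
Hypothesis scaleA : forall z a, sa_set A a -> sa_set A (sa_scale z a).
Hypothesis mulA : forall a b, sa_set A a -> sa_set A b -> sa_set A (sa_mul a b).
Hypothesis starA : forall a, sa_set A a -> sa_set A (sa_star a).

Definition completion_map (P : completion N) : completion N' :=
  (fun u => phi \o u) @` P.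

Lemma phi_inA a : sa_set A a -> sa_set B (phi a).
Proof. by case: phi_iso => -[+ _ _] _ _ _ _; apply. Qed.

Lemma phi_inj a b : sa_set A a -> sa_set A b -> phi a = phi b -> a = b.
Proof.
by case: phi_iso => -[_ + _] _ _ _ _ => phiI Aa Ab; apply: phiI; exact: mem_set.
Qed.

Lemma phi_dist a b : sa_set A a -> sa_set A b ->
  N' (sa_add (phi a) (sa_scale (-1) (phi b))) = N (sa_add a (sa_scale (-1) b)).
Proof.
case: phi_iso => _ phiD phiZ _ _ Aa Ab.
have Ab' : sa_set A (sa_scale (-1) b) by exact: scaleA.
by rewrite -phiZ// -phiD// phi_norm//; exact: addA.
Qed.

Lemma cauchy_phi (u : nat -> A) : (forall n, sa_set A (u n)) ->
  cauchy_in N' (phi \o u) <-> cauchy_in N u.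
Proof.
move=> Au; split=> -[_ uC]; split=> //.
- by move=> e /uC[M uM]; exists M => m n Mm Mn; rewrite -phi_dist//; exact: uM.
- by move=> n; exact: phi_inA.
- by move=> e /uC[M uM]; exists M => m n Mm Mn; rewrite phi_dist//; exact: uM.
Qed.

Lemma phi_lift_seq (v : nat -> B) : (forall n, sa_set B (v n)) ->
  exists2 u : nat -> A, (forall n, sa_set A (u n)) & v = phi \o u.
Proof.
case: phi_iso => -[_ _ phiS] _ _ _ _ vB.
have /choice[u uP] n : exists a, sa_set A a /\ phi a = v n.
  by have [a Aa av] := phiS _ (vB n); exists a.
by exists u => [n|]; [case: (uP n)|apply/funext => n /=; case: (uP n)].
Qed.

(** Stated for all sequences in [A], to apply to the termwise sums and products
    that occur in [lift2]. *)
Lemma completion_map_seq_class (s : nat -> A) : (forall n, sa_set A (s n)) ->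
  completion_map (seq_class N s) = seq_class N' (phi \o s).
Proof.
move=> As; have cot u : (forall n, sa_set A (u n)) ->
    coterminal N' (phi \o s) (phi \o u) <-> coterminal N s u.
  move=> Au; rewrite /coterminal.
  by under eq_fun do rewrite /= phi_dist//.
apply/seteqP; split=> [_ [u [uC su] <-]|v [vC sv]].
  by split; [apply/cauchy_phi => //; case: uC|apply/cot => //; case: uC].
have [u Au vE] := phi_lift_seq vC.1; rewrite vE in vC sv *.
by exists u => //; split; [exact/cauchy_phi|exact/cot].
Qed.

Lemma completion_set_in P u : sa_set (completion N) P -> P u ->
  forall n, sa_set A (u n).
Proof. by move=> [s _ <-] [[]]. Qed.

Lemma completion_map_lift1 (f : A -> A) (f' : B -> B) P :
  (forall a, sa_set A a -> sa_set A (f a)) ->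
  (forall a, sa_set A a -> phi (f a) = f' (phi a)) -> sa_set (completion N) P ->
  completion_map (lift1 N f P) = lift1 N' f' (completion_map P).
Proof.
move=> fA phif sP.
have E u : P u -> completion_map (seq_class N (f \o u)) = seq_class N' (f' \o (phi \o u)).
  move=> Pu; have Au := completion_set_in sP Pu.
  rewrite completion_map_seq_class => [|n]; last exact: fA.
  by congr seq_class; apply/funext => n /=; exact: phif.
apply/seteqP; split=> [_ [w [u Pu uw] <-]|v [_ [u Pu <-]]].
  by exists (phi \o u); [exists u|rewrite -E//; exists w].
by rewrite -E// => -[w uw <-]; exists w => //; exists u.
Qed.

Lemma completion_map_lift2 (f : A -> A -> A) (f' : B -> B -> B) P Q :
  (forall a b, sa_set A a -> sa_set A b -> sa_set A (f a b)) ->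
  (forall a b, sa_set A a -> sa_set A b -> phi (f a b) = f' (phi a) (phi b)) ->
  sa_set (completion N) P -> sa_set (completion N) Q ->
  completion_map (lift2 N f P Q) = lift2 N' f' (completion_map P) (completion_map Q).
Proof.
move=> fA phif sP sQ.
have E u v : P u -> Q v -> completion_map (seq_class N (fun n => f (u n) (v n))) =
    seq_class N' (fun n => f' (phi (u n)) (phi (v n))).
  move=> Pu Qv; have Au := completion_set_in sP Pu.
  have Av := completion_set_in sQ Qv.
  rewrite completion_map_seq_class => [|n]; last exact: fA.
  by congr seq_class; apply/funext => n /=; exact: phif.
apply/seteqP; split=> [_ [w [u [v [Pu Qv uvw]]] <-]|w [_ [_ [[u Pu <-] [v Qv <-]]]]].
  exists (phi \o u), (phi \o v); split; [by exists u|by exists v|].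
  by rewrite -E//; exists w.
by rewrite -E// => -[w' uvw <-]; exists w' => //; exists u, v.
Qed.

Lemma completion_map_iso : star_iso completion_map.
Proof.
have [[_ _ _] phiD phiZ phiM phiS] := phi_iso.
split.
- split.
  + move=> _ [u uC <-]; rewrite completion_map_seq_class; last by case: uC.
    by exists (phi \o u) => //; apply/cauchy_phi => //; case: uC.
  + have sub P Q : sa_set (completion N) P -> sa_set (completion N) Q ->
        completion_map P = completion_map Q -> P `<=` Q.
      move=> sP sQ PQ u Pu; have : completion_map P (phi \o u) by exists u.
      rewrite PQ => -[w Qw wu]; suff -> : u = w by [].
      apply/funext => n; apply: phi_inj.
      * exact: completion_set_in sP Pu n.
      * exact: completion_set_in sQ Qw n.
      * exact: (congr1 (fun v => v n) (esym wu)).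
    by move=> P Q /set_mem sP /set_mem sQ PQ; apply/seteqP; split; exact: sub.
  + move=> _ [v vC <-]; have [u Au vE] := phi_lift_seq vC.1.
    rewrite vE in vC *; exists (seq_class N u).
      by exists u => //; exact/cauchy_phi.
    exact: completion_map_seq_class.
- by move=> P Q sP sQ; exact: completion_map_lift2.
- by move=> z P sP; apply: completion_map_lift1 => // a; [exact: scaleA|exact: phiZ].
- by move=> P Q sP sQ; exact: completion_map_lift2.
- by move=> P sP; exact: completion_map_lift1.
Qed.

Lemma completion_map_norm P : sa_set (completion N) P ->
  completion_norm (completion_map P) = completion_norm P.
Proof.
move=> sP; rewrite /completion_norm; congr (xget _ _); apply/seteqP.
have E u : P u -> (fun n => N' (phi (u n))) = (fun n => N (u n)).
  move=> Pu; apply/funext => n; apply: phi_norm; exact: completion_set_in sP Pu n.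
split=> l lP u; first by move=> Pu; rewrite -E//; apply: (lP (phi \o u)); exists u.
by move=> [w Pw <-]; rewrite /= E//; exact: lP.
Qed.

Lemma completion_map_to_completion a : sa_set A a ->
  completion_map (to_completion N a) = to_completion N' (phi a).
Proof. by move=> Aa; exact: completion_map_seq_class. Qed.

Lemma completion_map_extension (I : choiceType) (V : normedZmodType R[i])
    (rho : A -> (I -> V) -> I -> V) (rho' : B -> (I -> V) -> I -> V) P T :
  (forall a, rho' (phi a) = rho a) ->
  extension_value rho' (completion_map P) T <-> extension_value rho P T.
Proof.
move=> rhoE; split=> ext u.
  move=> Pu; have := ext (phi \o u) (ex_intro2 _ _ u Pu erefl).
  by under eq_fun do rewrite /= rhoE.
by move=> [w Pw <-]; under eq_fun do rewrite /= rhoE; exact: ext.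
Qed.

End CompletionMap.

(** * The isomorphism of the reduced completions *)

Section CrossedProductClosed.
Variables (R : realType) (G : groupType) (Gam : groupClosed G).
Variables (X : Type) (act : raction X G).
Hypothesis hecke : Hecke_pair Gam.

Local Notation cp := (crossed_product R Gam act).
Local Notation cp_set := (@cp_set R G Gam X act).

(** The crossed product is closed under its operations because the isomorphic
    algebra is, where supports are easier to follow. *)
Lemma cp_setD (f1 f2 : cp) : cp_set f1 -> cp_set f2 -> cp_set (sa_add f1 f2).
Proof.
move=> /(cp_set_PhiE hecke) s1 /(cp_set_PhiE hecke) s2.
by apply/(cp_set_PhiE hecke); rewrite Phi_add; exact: lln_setD.
Qed.

Lemma cp_setZ z (f : cp) : cp_set f -> cp_set (sa_scale z f).
Proof.
move=> /(cp_set_PhiE hecke) s.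
by apply/(cp_set_PhiE hecke); rewrite Phi_scale; exact: lln_setZ.
Qed.

Lemma cp_setM (f1 f2 : cp) : cp_set f1 -> cp_set f2 -> cp_set (sa_mul f1 f2).
Proof.
move=> /(cp_set_PhiE hecke) s1 /(cp_set_PhiE hecke) s2.
by apply/(cp_set_PhiE hecke); rewrite (Phi_mul hecke); exact: lln_set_mul.
Qed.

Lemma cp_set_star (f : cp) : cp_set f -> cp_set (sa_star f).
Proof.
move=> sf; apply/(cp_set_PhiE hecke); rewrite (Phi_star hecke sf).
by apply: lln_set_star; exact/(cp_set_PhiE hecke).
Qed.

End CrossedProductClosed.

Theorem theorem3p26 (R : realType) (G : groupType) (Gam : groupClosed G)
    (X : Type) (act : raction X G)
    (hecke : Hecke_pair Gam) (inter : intersection_property act Gam) :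
  [/\ star_iso (@Phi R G Gam X act),
      exists Psi : cp_reduced R Gam act -> lln_reduced R Gam act,
        [/\ star_iso Psi,
            forall P, sa_set (cp_reduced R Gam act) P ->
              completion_norm (Psi P) = completion_norm P,
            forall f, sa_set (crossed_product R Gam act) f ->
              Psi (to_completion (@cp_norm R G Gam X act) f) =
              to_completion (@lln_norm R G Gam X act) (Phi f) &
            forall (x : X) P T, sa_set (cp_reduced R Gam act) P ->
              extension_value (A := lln_algebra R Gam act) (lln_rep act x) (Psi P) T <->
              extension_value (A := crossed_product R Gam act) (cp_rep act (ev x)) P T] &
      forall (x : X) f, sa_set (crossed_product R Gam act) f ->
        forall v, l2 R[i] v ->
          lln_rep act x (Phi f) v = cp_rep act (ev x) f v].
Proof.
have iso := @Phi_star_iso R G Gam X act hecke.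
have nrm : forall f, sa_set (crossed_product R Gam act) f ->
    lln_norm (Phi f) = cp_norm f := @cp_norm_Phi R G Gam X act.
have clD := @cp_setD R G Gam X act hecke.
have clZ := @cp_setZ R G Gam X act hecke.
have clM := @cp_setM R G Gam X act hecke.
have clS := @cp_set_star R G Gam X act hecke.
split=> //; last by move=> x f _ v _; exact: lln_rep_Phi.
exists (@completion_map R (crossed_product R Gam act) (lln_algebra R Gam act)
  (@cp_norm R G Gam X act) (@lln_norm R G Gam X act) (@Phi R G Gam X act)).
split.
- exact: completion_map_iso.
- exact: completion_map_norm.
- exact: completion_map_to_completion.
- move=> x P T _; apply: completion_map_extension => f.
  by apply/funext => v; exact: lln_rep_Phi.
Qed.
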